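(* Let $W$ be the affine Coxeter group of type $\widetilde C_2$, i.e. $W=\langle s_0,s_1,s_2\mid s_i^2=1,\ (s_0s_1)^4=(s_1s_2)^4=(s_0s_2)^2=1\rangle$. Then the Cayley graph of $W$ with respect to $S=\{s_0,s_1,s_2\}$ satisfies the strong hull property: for all $u,v,w\in W$, $|\mathrm{Conv}(u,v)|\cdot|\mathrm{Conv}(v,w)|\ge|\mathrm{Conv}(u,v,w)|$.
   Context: The Cayley graph has vertex set $W$, with $u,v$ adjacent iff $u^{-1}v\in S$; $d$ is the shortest-path distance. A vertex set $C$ is convex if $u,v\in C$ and $d(u,w)+d(w,v)=d(u,v)$ imply $w\in C$. $\mathrm{Conv}(X)$ is the smallest convex set containing $X$, and $\mathrm{Conv}(u,v)=\mathrm{Conv}(\{u,v\})$, etc. *)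

(* Defs.v *)
From HB Require Import structures.
From mathcomp Require Import all_boot.
From mathcomp Require Import boolp classical_sets functions cardinality.

Set Implicit Arguments.
Unset Strict Implicit.
Unset Printing Implicit Defensive.

Local Open Scope quotient_scope.
Local Open Scope classical_set_scope.
Local Open Scope card_scope.
Local Open Scope group_scope.

(* The group < I | R >: words in signed letters, (i, true) standing for the    *)
(* generator i and (i, false) for its inverse, modulo the least congruence for *)
(* concatenation that cancels adjacent inverse letters and kills the relators. *)
Section Presentation.
Variables (I : choiceType) (R : seq (seq (I * bool))).
Local Notation word := (seq (I * bool)).

Inductive word_equiv : word -> word -> Prop :=
| WordRefl w : word_equiv w w
| WordSym w1 w2 : word_equiv w1 w2 -> word_equiv w2 w1
| WordTrans w1 w2 w3 :
    word_equiv w1 w2 -> word_equiv w2 w3 -> word_equiv w1 w3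
| WordCat w1 w1' w2 w2' :
    word_equiv w1 w1' -> word_equiv w2 w2' ->
    word_equiv (w1 ++ w2) (w1' ++ w2')
| WordCancel i b : word_equiv [:: (i, b); (i, ~~ b)] [::]
| WordRelator r : r \in R -> word_equiv r [::].

Definition word_eqb (w1 w2 : word) : bool := `[< word_equiv w1 w2 >].

Lemma word_eqb_equiv : equiv_class_of word_eqb.
Proof.
split.
- by move=> w; apply/asboolP; exact: WordRefl.
- by move=> w1 w2; apply/asboolP/asboolP; exact: WordSym.
- move=> w2 w1 w3 /asboolP h12 /asboolP h23; apply/asboolP.
  exact: WordTrans h12 h23.
Qed.

Canonical word_eqb_rel := EquivRelPack word_eqb_equiv.

Definition presented : Type := {eq_quot word_eqb}.
HB.instance Definition _ := Choice.on presented.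
HB.instance Definition _ := Quotient.on presented.

Definition word_class (w : word) : presented := \pi_presented w.

Lemma word_classP w1 w2 : word_class w1 = word_class w2 <-> word_equiv w1 w2.
Proof. by split=> [/eqquotP/asboolP|h] //; apply/eqquotP/asboolP. Qed.

Lemma word_class_repr x : word_class (repr x) = x.
Proof. exact: reprK. Qed.

Lemma repr_word_class w : word_equiv (repr (word_class w)) w.
Proof. by apply/word_classP; rewrite word_class_repr. Qed.

Definition word_inv (w : word) : word := [seq (l.1, ~~ l.2) | l <- rev w].

Lemma word_invK : involutive word_inv.
Proof.
move=> w; rewrite /word_inv -map_rev revK -map_comp -[RHS]map_id.
by apply: eq_map => -[i b] /=; rewrite negbK.
Qed.

Lemma word_mulV w : word_equiv (w ++ word_inv w) [::].
Proof.
elim: w => [|[i b] w IHw]; first exact: WordRefl.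
rewrite /word_inv rev_cons map_rcons -/(word_inv w) /= -cats1 catA.
apply: (@WordTrans _ ([:: (i, b)] ++ ([::] ++ [:: (i, ~~ b)]))).
  by apply: (WordCat (WordRefl [:: (i, b)])); apply: WordCat IHw (WordRefl _).
exact: WordCancel.
Qed.

Lemma word_Vmul w : word_equiv (word_inv w ++ w) [::].
Proof. by have := word_mulV (word_inv w); rewrite word_invK. Qed.

Lemma word_inv_equiv w1 w2 :
  word_equiv w1 w2 -> word_equiv (word_inv w1) (word_inv w2).
Proof.
move=> h12.
have h1 : word_equiv (word_inv w1) (word_inv w1 ++ (w2 ++ word_inv w2)).
  rewrite -[X in word_equiv X _]cats0.
  exact: WordCat (WordRefl _) (WordSym (word_mulV w2)).
apply: (WordTrans h1); rewrite catA.
rewrite -[X in word_equiv _ X]cat0s; apply: WordCat (WordRefl _).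
apply: WordTrans (word_Vmul w1).
exact: WordCat (WordRefl _) (WordSym h12).
Qed.

Definition presented_one : presented := word_class [::].
Definition presented_inv (x : presented) : presented :=
  word_class (word_inv (repr x)).
Definition presented_mul (x y : presented) : presented :=
  word_class (repr x ++ repr y).

Lemma presented_mulE w1 w2 :
  presented_mul (word_class w1) (word_class w2) = word_class (w1 ++ w2).
Proof. by apply/word_classP; apply: WordCat; exact: repr_word_class. Qed.

Lemma presented_invE w :
  presented_inv (word_class w) = word_class (word_inv w).
Proof. by apply/word_classP/word_inv_equiv; exact: repr_word_class. Qed.

Lemma presented_mulA : associative presented_mul.
Proof.
move=> x y z.
rewrite -(word_class_repr x) -(word_class_repr y) -(word_class_repr z).
by rewrite !presented_mulE catA.
Qed.

Lemma presented_mul1 : left_id presented_one presented_mul.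
Proof. by move=> x; rewrite -(word_class_repr x) presented_mulE. Qed.

Lemma presented_mulr1 : right_id presented_one presented_mul.
Proof. by move=> x; rewrite -(word_class_repr x) presented_mulE cats0. Qed.

Lemma presented_mulV :
  left_inverse presented_one presented_inv presented_mul.
Proof.
move=> x; rewrite -(word_class_repr x) presented_invE presented_mulE.
by apply/word_classP; exact: word_Vmul.
Qed.

Lemma presented_mulrV :
  right_inverse presented_one presented_inv presented_mul.
Proof.
move=> x; rewrite -(word_class_repr x) presented_invE presented_mulE.
by apply/word_classP; exact: word_mulV.
Qed.

HB.instance Definition _ := isGroup.Build presented presented_mulA
  presented_mul1 presented_mulr1 presented_mulV presented_mulrV.

Lemma word_classM w1 w2 :
  word_class (w1 ++ w2) = word_class w1 * word_class w2.
Proof. by rewrite -presented_mulE. Qed.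

Lemma word_classV w : word_class (word_inv w) = (word_class w)^-1.
Proof. by rewrite -presented_invE. Qed.

Definition presented_gen (i : I) : presented := word_class [:: (i, true)].

End Presentation.

Section GraphConvexity.
Variables (T : choiceType) (e : rel T).

Definition walk_length (u v : T) : set nat :=
  [set n | exists p : seq T, [/\ path e u p, last u p = v & size p = n]].

(* The default value 0 is only reached when u and v are not connected. *)
Definition graph_dist (u v : T) : nat :=
  xget 0%N [set n | walk_length u v n /\
                    forall m, walk_length u v m -> (n <= m)%N].

Definition graph_convex (C : set T) : Prop :=
  forall u v w, C u -> C v ->
    (graph_dist u w + graph_dist w v)%N = graph_dist u v -> C w.

Definition convex_hull (X : set T) : set T := smallest graph_convex X.

(* |A| * |B| >= |C| is stated between cardinals, as an injection from C into   *)
(* A x B, so that it does not presuppose the finiteness of the hulls.          *)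
Definition strong_hull_property : Prop :=
  forall u v w : T,
    convex_hull [set u; v; w] #<=
      convex_hull [set u; v] `*` convex_hull [set v; w].

Lemma graph_distP u v : walk_length u v !=set0 ->
  walk_length u v (graph_dist u v) /\
  forall m, walk_length u v m -> (graph_dist u v <= m)%N.
Proof.
case=> n0 h0; rewrite /graph_dist; case: xgetP => [n -> //|none].
have ex : exists n, `[< walk_length u v n >] by exists n0; apply/asboolP.
case: (ex_minnP ex) => n /asboolP hn minn.
by case: (none n); split=> // m hm; apply: minn; apply/asboolP.
Qed.

End GraphConvexity.

Definition cayley_graph (G : groupType) (S : set G) : rel G :=
  fun u v => u^-1 * v \in S.

Definition c2_index0 : 'I_3 := @Ordinal 3 0 isT.
Definition c2_index1 : 'I_3 := @Ordinal 3 1 isT.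
Definition c2_index2 : 'I_3 := @Ordinal 3 2 isT.

Definition power_relator (I : Type) (m : nat) (l : seq I) : seq (I * bool) :=
  [seq (i, true) | i <- flatten (nseq m l)].

Definition affine_C2_relators : seq (seq ('I_3 * bool)) :=
  [:: power_relator 2 [:: c2_index0];
      power_relator 2 [:: c2_index1];
      power_relator 2 [:: c2_index2];
      power_relator 4 [:: c2_index0; c2_index1];
      power_relator 4 [:: c2_index1; c2_index2];
      power_relator 2 [:: c2_index0; c2_index2]].

Definition affine_C2 : groupType := presented affine_C2_relators.

Definition affine_C2_gen (i : 'I_3) : affine_C2 :=
  presented_gen affine_C2_relators i.

Definition affine_C2_cayley : rel affine_C2 :=
  cayley_graph (range affine_C2_gen).

Lemma affine_C2_genK i : affine_C2_gen i * affine_C2_gen i = 1.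
Proof.
rewrite -word_classM; apply/word_classP/WordRelator.
by case: i => -[|[|[|//]]] lt_i; rewrite !inE.
Qed.

Lemma affine_C2_connected (u v : affine_C2) :
  walk_length affine_C2_cayley u v !=set0.
Proof.
have [w def_v] : exists w, v = u * word_class affine_C2_relators w.
  by exists (repr (u^-1 * v)); rewrite word_class_repr mulVKg.
elim: w u def_v => [|[i b] w IHw] u def_v.
  by exists 0%N, [::]; split=> //=; rewrite def_v [RHS]mulg1.
have gen_inv : word_class affine_C2_relators [:: (i, b)] = affine_C2_gen i.
  case: b {def_v} => //; apply: (can_inj (mulgK (affine_C2_gen i))).
  rewrite affine_C2_genK -word_classM.
  exact/word_classP/(@WordCancel _ _ i false).
have [|n [p [pP lastp sizep]]] := IHw (u * affine_C2_gen i).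
  by rewrite def_v -mulgA -gen_inv -word_classM.
exists n.+1, (u * affine_C2_gen i :: p); split=> //=; last by rewrite sizep.
rewrite pP andbT /affine_C2_cayley /cayley_graph mulKg.
by apply/mem_set; exists i.
Qed.

(* Main.v *)
(* The elements of W are the alcoves of the tiling of the plane by the lines  *)
(* x = k, y = k, x + y = 2k and x - y = 2k.  An alcove is determined by the   *)
(* four integers P, Q, R, S counting the lines of each direction below it,    *)
(* and the graph distance is the l1 distance of these coordinates; hence      *)
(* Conv(u, v) is the set of alcoves whose coordinates lie between those of u  *)
(* and v, and Conv(u, v, w) is contained in the analogous box.  If u = v the  *)
(* inequality is clear.  If u and v are adjacent, the part of the box beyond  *)
(* their common wall is folded into Conv(v, w) by the reflection in that      *)
(* wall, so the box has at most 2 |Conv(v, w)| elements.  If d(v, u), d(v, w) *)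
(* >= 2, two coordinates of the box already suffice: with W_c the number of   *)
(* values of the coordinate c, the box has at most 2 W_P W_Q, 4 W_R W_S, 4    *)
(* W_P W_R, ..., 4 W_Q W_S elements, while |Conv(v, u)| is at least 1 + d(v,  *)
(* u) and, up to a symmetry of the tiling and up to a loss of at most 8, the  *)
(* number of alcoves of the parallelogram cut out by the coordinates Q and S. *)
(* In every case one of the six upper bounds is at most the product of the    *)
(* lower bounds; this polynomial inequality is checked by computation.        *)

From HB Require Import structures.
From mathcomp Require Import all_boot.
From mathcomp Require Import boolp classical_sets functions cardinality.
From mathcomp Require Import zify ssrZ.
From Stdlib Require Import ZArith Lia.
From Stdlib.micromega Require Import RingMicromega ZMicromega EnvRing Env.
Require Import Defs.

Set Implicit Arguments.
Unset Strict Implicit.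
Unset Printing Implicit Defensive.

Local Arguments Z.add : simpl never.
Local Arguments Z.sub : simpl never.
Local Arguments Z.mul : simpl never.

Local Open Scope Z_scope.

(** * Polynomial inequalities over the nonnegative integers *)

(** The Cayley graph is the dual graph of the tiling: [step] crosses a wall, the resulting action of
    the group on alcoves is simply transitive ([alcove_ofK], [alcove_of_surj]), and the distance
    counts separating lines ([descent], [graph_dist_adist]). A hull of two points therefore contains
    their coordinate interval, while a hull of three points lies in a box, since boxes are convex
    ([between3_convex]). This reduces the theorem to the count [size_hull3_le_mul].

    When [v] and [u] are adjacent, folding across their common wall at most doubles the interval
    ([size_hull3_adjacent]). Otherwise widths add while sizes multiply. Up to rounding and symmetry,
    P = Q + 2 S and R = Q + S along an interval, so an interval fills the parallelogram of its Q and
    S ranges except near two corners ([interval_area], [shapedP]), whereas the box is bounded by two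
    or four times the product of any two of its widths ([hull3_area]). The rounding terms take
    finitely many values, which leaves a finite family of polynomial inequalities in four
    nonnegative integers ([area_checks]). *)

Local Notation pexpr := (PExpr Z).
Local Notation peval := ZMicromega.eval_expr.

Fixpoint pol_ge0 (p : Pol Z) : bool :=
  match p with
  | Pc c => (0 <=? c)%Z
  | Pinj _ q => pol_ge0 q
  | PX q _ r => pol_ge0 q && pol_ge0 r
  end.

Lemma pol_ge0P (env : PolEnv Z) p :
  (forall i, 0 <= env i)%Z -> pol_ge0 p -> (0 <= eval_pol env p)%Z.
Proof.
rewrite /eval_pol /RingMicromega.eval_pol.
elim: p env => [c|j q IH|q IHq i r IHr] env env0 /=.
- by move/Z.leb_le.
- by move=> q0; apply: IH q0 => k; apply: env0.
- case/andP=> q0 r0; have a0 := IHq _ env0 q0.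
  have b0 := IHr (tail env) (fun i => env0 _) r0.
  have pow0 k : (0 <= pow_pos Z.mul (hd env) k)%Z.
    have h0 : (0 <= hd env)%Z by apply: env0.
    by elim: k => [k IH|k IH|] //=; nia.
  by apply: Z.add_nonneg_nonneg b0; apply: Z.mul_nonneg_nonneg a0 (pow0 i).
Qed.

Fixpoint psubst (f : positive -> pexpr) (e : pexpr) : pexpr :=
  match e with
  | PEc c => PEc c
  | PEX i => f i
  | PEadd e1 e2 => PEadd (psubst f e1) (psubst f e2)
  | PEsub e1 e2 => PEsub (psubst f e1) (psubst f e2)
  | PEmul e1 e2 => PEmul (psubst f e1) (psubst f e2)
  | PEopp e1 => PEopp (psubst f e1)
  | PEpow e1 n => PEpow (psubst f e1) n
  end.

Lemma peval_psubst env f e :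
  peval env (psubst f e) = peval (fun i => peval env (f i)) e.
Proof.
by rewrite /peval /eval_pexpr; elim: e => //= *; congruence.
Qed.

Lemma eq_peval (env env' : PolEnv Z) e :
  (forall i, env i = env' i) -> peval env e = peval env' e.
Proof. by rewrite /peval /eval_pexpr => eqe; elim: e => //= *; congruence. Qed.

Lemma peval_arith env :
  (((forall c, peval env (PEc c) = c) *
    (forall e f, peval env (PEadd e f) = peval env e + peval env f)%Z) *
   ((forall e f, peval env (PEsub e f) = peval env e - peval env f)%Z *
    (forall e f, peval env (PEmul e f) = peval env e * peval env f)%Z))%type.
Proof. by []. Qed.

Definition peval_ge0 env e := (0 <= peval env e)%Z.

(* A cell assigns to the variable [i] a pair [(c, b)]: its value is [c] if [b] *)
(* is false and an arbitrary integer [>= c] otherwise.                         *)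
Definition cell := positive -> Z * bool.

Definition in_cell (c : cell) (env : PolEnv Z) :=
  forall i, (if (c i).2 then (c i).1 <= env i else env i = (c i).1)%Z.

Definition cell_expr (c : cell) (i : positive) : pexpr :=
  if (c i).2 then PEadd (PEc (c i).1) (PEX i) else PEc (c i).1.

Definition cell_set (c : cell) (i : positive) x : cell :=
  fun j => if Pos.eqb i j then x else c j.

(** A sufficient test: once every free variable is shifted by its lower bound, all coefficients are
    nonnegative. *)
Definition cell_ge0 (c : cell) (e : pexpr) :=
  pol_ge0 (normZ (psubst (cell_expr c) e)).

Lemma cell_ge0P c env e : in_cell c env -> cell_ge0 c e -> peval_ge0 env e.
Proof.
move=> cE; rewrite /cell_ge0 => ge0.
pose env' i := if (c i).2 then (env i - (c i).1)%Z else 0%Z.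
have env'0 i : (0 <= env' i)%Z by have := cE i; rewrite /env'; case: (c i).2; lia.
have := pol_ge0P env'0 ge0.
rewrite -eval_pol_norm peval_psubst /peval_ge0.
suff envE i : peval env' (cell_expr c i) = env i by rewrite (eq_peval _ envE).
have := cE i; rewrite /cell_expr /peval /eval_pexpr /env'.
case ci: (c i).2 => /= cEi; rewrite ?cEi //.
by rewrite /Env.nth ci; lia.
Qed.

(* Unlike [has], this does not evaluate the tail of the sequence when the head *)
(* succeeds, since call-by-value computes both arguments of [||].              *)
Fixpoint lazy_has (T : Type) (a : pred T) s :=
  if s is x :: s' then if a x then true else lazy_has a s' else false.

Lemma lazy_hasP (T : Type) (a : pred T) s :
  lazy_has a s -> exists2 x, List.In x s & a x.
Proof.
elim: s => [|x s IH] /=; first by [].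
case: ifP => [ax _|_ has_s]; first by exists x; [left|].
by have [y ys ay] := IH has_s; exists y; [right|].
Qed.

(** Over the integers [e < 0] means [-1 - e >= 0], so the same coefficient test serves to refute a
    hypothesis. *)
Definition cell_check (hyps concls : seq pexpr) (c : cell) :=
  if lazy_has (fun e => cell_ge0 c (PEsub (PEc (-1)%Z) e)) hyps then true
  else lazy_has (cell_ge0 c) concls.

(* Splits the cell on the variables in [order], into the face where the        *)
(* variable takes its least value and the rest, until some hypothesis is       *)
(* contradicted or some conclusion has nonnegative coefficients.               *)
Fixpoint split_check hyps concls (order : seq positive) (c : cell) : bool :=
  if cell_check hyps concls c then true else
  if order is i :: order' then
    if (c i).2 then
      if split_check hyps concls order' (cell_set c i ((c i).1, false)) then
        split_check hyps concls order' (cell_set c i ((c i).1 + 1, true)%Z)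
      else false
    else split_check hyps concls order' c
  else false.

Lemma split_checkP hyps concls order c env :
    split_check hyps concls order c -> in_cell c env ->
    (forall e, List.In e hyps -> peval_ge0 env e) ->
  exists2 e, List.In e concls & peval_ge0 env e.
Proof.
move=> + + hypsP.
have checkP c' : cell_check hyps concls c' -> in_cell c' env ->
    exists2 e, List.In e concls & peval_ge0 env e.
  rewrite /cell_check; case: ifP => hypsC; last first.
    move=> hasC cE; have [e eIn ge0] := lazy_hasP hasC.
    by exists e => //; apply: cell_ge0P ge0.
  move=> _ cE; have [e eIn ge0] := lazy_hasP hypsC.
  have := hypsP e eIn; have := cell_ge0P cE ge0.
  rewrite /peval_ge0.
  have -> : peval env (PEsub (PEc (-1)%Z) e) = (-1 - peval env e)%Z by [].
  lia.
elim: order c => [|i order IH] c /=; case: ifP => okc splitc cE //;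
  try exact: checkP okc cE.
move: splitc; case: ifP => ci; last by move/IH; apply.
case: ifP => // /IH IH0 /IH IH1; have := cE i; rewrite ci => ci_le.
have [eqc|neqc] := Z.eq_dec (env i) (c i).1.
  apply: IH0 => j; rewrite /cell_set.
  by case: Pos.eqb_spec => [<-|_] //=; apply: cE.
apply: IH1 => j; rewrite /cell_set.
by case: Pos.eqb_spec => [<-|_] /=; [lia|exact: cE].
Qed.

(* An interval from v to u along which all coordinates increase, by b in Q, by *)
(* b + 2 d + m1 in P, by d in S and by b + d + m2 in R, has at least           *)
(* 4 (b + 1) (d + 1) - l elements, where (m1, m2, l) is an entry of this table *)
(* depending on the types of the alcoves v and u.                              *)
Definition loss_table : seq (Z * Z * Z) :=
  [:: (0, 0, 4); (-1, -1, 6); (1, 0, 2); (0, -1, 4); (1, 1, 1); (2, 1, 0);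
      (-1, 0, 5); (-2, -1, 8); (0, 1, 2)]%Z.

Section AreaProduct.
Local Notation "x + y" := (PEadd x y).
Local Notation "x - y" := (PEsub x y).
Local Notation "x * y" := (PEmul x y).
Local Notation "'C' n" := (PEc n%Z) (at level 0, n at level 0).

Definition long_short (b d : pexpr) (m : Z) := b + C 2 * d + PEc m.
Definition long_diag (b d : pexpr) (m : Z) := b + d + PEc m.
Definition area_bound b d (l : Z) : pexpr := C 4 * (b + C 1) * (d + C 1) - PEc l.
Definition len_bound b d (m1 m2 : Z) : pexpr :=
  C 1 + b + d + long_short b d m1 + long_diag b d m2.

Definition area_hyps (E : Z * Z * Z) b d : seq pexpr :=
  let: (m1, m2, l) := E in
  [:: long_short b d m1; long_diag b d m2; len_bound b d m1 m2 - C 3].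

(* The two intervals are in the positions described by [E], b, d and [E'], b', *)
(* d', the roles of P, Q (if [t1]) and of R, S (if [t2]) being exchanged for   *)
(* the second one.  These seven combinations of a lower bound for the product  *)
(* and an upper bound for the box were found by search to be sufficient.       *)
Definition area_concls (E E' : Z * Z * Z) (t1 t2 : bool) b d b' d' : seq pexpr :=
  let: (m1, m2, l) := E in let: (m1', m2', l') := E' in
  let width x x' := C 1 + x + x' in
  let: (p, q) := (long_short b d m1, b) in
  let: (r, s) := (long_diag b d m2, d) in
  let: (lp, lr) := (long_short b' d' m1', long_diag b' d' m2') in
  let: (p', q') := if t1 then (b', lp) else (lp, b') in
  let: (r', s') := if t2 then (d', lr) else (lr, d') in
  let wp := width p p' in let wq := width q q' in
  let wr := width r r' in let ws := width s s' in
  let: (a, n) := (area_bound b d l, len_bound b d m1 m2) in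
  let: (a', n') := (area_bound b' d' l', len_bound b' d' m1' m2') in
  [:: a * a' - C 4 * wq * ws; a * n' - C 4 * wr * ws; n * a' - C 4 * wp * ws;
      n * a' - C 4 * wq * wr; n * a' - C 4 * wp * wr; n * a' - C 4 * wr * ws;
      n * n' - C 2 * wp * wq].

End AreaProduct.

(** Each variable is split at most five times: its values 0 to 4 become constants, and what remains
    is a shift by 5. *)
Definition split_order : seq positive :=
  List.concat (nseq 5 [:: 1; 2; 3; 4])%positive.

(* The booleans [c1], [c2] tell which of b, b' and of d, d' is the least: the  *)
(* variables are the minimum and the difference of both pairs.                 *)
Definition area_check E E' t1 t2 c1 c2 :=
  let x := PEX 1%positive in let y := PEX 3%positive in
  let x' := PEadd x (PEX 2%positive) in let y' := PEadd y (PEX 4%positive) in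
  let: (b, b') := if c1 then (x, x') else (x', x) in
  let: (d, d') := if c2 then (y, y') else (y', y) in
  split_check (area_hyps E b d ++ area_hyps E' b' d')
    (area_concls E E' t1 t2 b d b' d') split_order (fun => (0%Z, true)).

Definition all_bool (Q : pred bool) := Q false && Q true.

Lemma all_boolP Q t : all_bool Q -> Q t.
Proof. by case: t => /andP[]. Qed.

Definition all_cases (T : eqType) (s : seq T)
    (P : T -> T -> bool -> bool -> bool -> bool -> bool) :=
  all (fun x => all (fun y => all_bool (fun t1 => all_bool (fun t2 =>
    all_bool (fun c1 => all_bool (fun c2 => P x y t1 t2 c1 c2))))) s) s.

Lemma all_casesP (T : eqType) (s : seq T) P x y t1 t2 c1 c2 :
  all_cases s P -> x \in s -> y \in s -> P x y t1 t2 c1 c2.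
Proof.
move=> /allP + xs ys => /(_ _ xs)/allP/(_ _ ys).
by move=> /(all_boolP t1)/(all_boolP t2)/(all_boolP c1)/(all_boolP c2).
Qed.

(** There are 9 * 9 pairs of table entries and 16 choices of booleans, hence 1296 runs of
    [split_check], all evaluated by the kernel. *)
Lemma area_checks : all_cases loss_table area_check.
Proof. vm_cast_no_check (erefl true). Qed.

Lemma area_product_std E E' (t1 t2 : bool) b d b' d' n n' :
    E \in loss_table -> E' \in loss_table ->
    0 <= b -> 0 <= d -> 0 <= b' -> 0 <= d' ->
  let: (m1, m2, l) := E in let: (m1', m2', l') := E' in
  let: (p, q, r, s) := (b + 2 * d + m1, b, b + d + m2, d) in
  let: (u', v', x', y') := (b' + 2 * d' + m1', b', b' + d' + m2', d') in
  let: (p', q') := if t1 then (v', u') else (u', v') in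
  let: (r', s') := if t2 then (y', x') else (x', y') in
  0 <= p -> 0 <= r -> 0 <= u' -> 0 <= x' ->
  2 <= p + q + r + s -> 2 <= u' + v' + x' + y' ->
  4 * (b + 1) * (d + 1) - l <= n -> 1 + p + q + r + s <= n ->
  4 * (b' + 1) * (d' + 1) - l' <= n' -> 1 + p' + q' + r' + s' <= n' ->
  [\/ 2 * (1 + p + p') * (1 + q + q') <= n * n',
      4 * (1 + r + r') * (1 + s + s') <= n * n' |
   [\/ 4 * (1 + p + p') * (1 + r + r') <= n * n',
      4 * (1 + p + p') * (1 + s + s') <= n * n',
      4 * (1 + q + q') * (1 + r + r') <= n * n' |
      4 * (1 + q + q') * (1 + s + s') <= n * n']].
Proof.
case: E => [[m1 m2] l]; case: E' => [[m1' m2'] l'] Ein E'in b0 d0 b'0 d'0.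
pose env : PolEnv Z := fun i => match i with
  | 1 => Z.min b b' | 2 => Z.abs (b - b')
  | 3 => Z.min d d' | _ => Z.abs (d - d') end%positive.
have envC : in_cell (fun=> (0, true)) env.
  by move=> i /=; rewrite /env; case: i => [[]|[[]|[]|]|]; lia.
have := all_casesP t1 t2 (b <=? b') (d <=? d') area_checks Ein E'in.
rewrite /area_check.
have exprs (x y : Z) (e e' : pexpr) : peval env e = Z.min x y ->
    peval env e' = Z.abs (x - y) -> exists f f' : pexpr,
    [/\ (if x <=? y then (e, PEadd e e') else (PEadd e e', e)) = (f, f'),
        peval env f = x & peval env f' = y].
  move=> eE e'E; have ee'E : peval env (PEadd e e') = Z.min x y + Z.abs (x - y).
    by rewrite -eE -e'E.
  case: Z.leb_spec => xy; [exists e, (PEadd e e')|exists (PEadd e e'), e];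
    by rewrite ee'E eE; split=> //; lia.
have [//|//|fb [fb' [-> fbE fb'E]]] := exprs b b' (PEX 1) (PEX 2).
have [//|//|fd [fd' [-> fdE fd'E]]] := exprs d d' (PEX 3) (PEX 4).
(* Lower bounds can be multiplied only when they are nonnegative. The loss reaches 8, but then the
   nonnegativity of the long sides excludes the small values of [x] and [y]. *)
have area_ge0 m m' k x y : (m, m', k) \in loss_table -> 0 <= x -> 0 <= y ->
    0 <= x + 2 * y + m -> 0 <= x + y + m' -> 0 <= 4 * (x + 1) * (y + 1) - k.
  move=> + x0 y0; have xy0 := Z.mul_nonneg_nonneg _ _ x0 y0.
  by rewrite !inE => /or4P[|||/or4P[|||/or3P[]]] /eqP[-> -> ->]; lia.
move=> /split_checkP/(_ envC) checkP.
have [u' u'E] : exists x, x = b' + 2 * d' + m1' by exists (b' + 2 * d' + m1').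
have [x' x'E] : exists x, x = b' + d' + m2' by exists (b' + d' + m2').
rewrite -u'E -x'E.
case pq: (if t1 then _ else _) => [p' q'].
case rs: (if t2 then _ else _) => [r' s'].
move=> p0 r0 p'0 r'0 len len' n_area n_len n'_area n'_len.
have arith := (peval_arith env, fbE, fb'E, fdE, fd'E).
have [e|e + e_ge0] := checkP _.
  rewrite /peval_ge0 /= /len_bound /long_short /long_diag => eIn.
  do 6![case: eIn => [<-|eIn]; first by rewrite !arith; lia].
  by case: eIn.
move=> eIn; move: e_ge0; rewrite /peval_ge0 => e_ge0.
have prod_le g h w : 0 <= g * h - w ->
    0 <= g -> 0 <= h -> g <= n -> h <= n' -> w <= n * n' by nia.
have a0 := area_ge0 _ _ _ _ _ Ein b0 d0 p0 r0.
have a'0 : 0 <= 4 * (b' + 1) * (d' + 1) - l'.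
  by apply: area_ge0 E'in b'0 d'0 _ _; lia.
have {}n'_len : 1 + b' + d' + u' + x' <= n'.
  by case: (t1) pq => -[pE qE]; case: (t2) rs => -[rE sE]; lia.
move: eIn e_ge0.
rewrite /area_concls /area_bound /len_bound /long_short /long_diag.
case: (t1) pq => -[<- <-]; case: (t2) rs => -[<- <-] eIn e_ge0;
  rewrite /= in eIn.
all: do 6?[case: eIn => [eE|eIn]]; try case: eIn => // eE.
all: move: e_ge0; rewrite -eE ?arith -?u'E -?x'E => e_ge0.
all: have w_le := prod_le _ _ _ e_ge0 ltac:(lia) ltac:(lia) ltac:(lia)
  ltac:(lia).
all: first [exact: Or31 | exact: Or32 | apply: Or33;
  first [exact: Or41 | exact: Or42 | exact: Or43 | exact: Or44]].
Qed.

(** * Alcoves *)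

(* (r, s, a, b) is one of the four alcoves contained in the square             *)
(* 2r < x + y < 2r + 2, 2s < x - y < 2s + 2; they are separated by the lines   *)
(* x = r + s + 1 (a tells the side) and y = r - s (b tells the side).          *)
Definition alcove : Type := (Z * Z * bool * bool)%type.
HB.instance Definition _ := Choice.on alcove.

Implicit Types (z u v w h : alcove).

Definition Z_of_bool (b : bool) : Z := if b then 1 else 0.
(* The integral parts of (x + y) / 2, (x - y) / 2, x and y.                    *)
Definition cR z : Z := let: (r, s, a, b) := z in r.
Definition cS z : Z := let: (r, s, a, b) := z in s.
Definition cP z : Z := let: (r, s, a, b) := z in r + s + Z_of_bool a.
Definition cQ z : Z := let: (r, s, a, b) := z in r - s - 1 + Z_of_bool b.

Lemma coords_inj u v :
  cP u = cP v -> cQ u = cQ v -> cR u = cR v -> cS u = cS v -> u = v.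
Proof.
case: u v => [[[r s] a] b] [[[r' s'] a'] b'] /= ep eq er es.
by rewrite er es in ep eq *; case: a a' b b' ep eq => [] [] [] []//=; lia.
Qed.

(* The neighbour across the wall of type [i]: the hypotenuse for [i = 1], and  *)
(* one of the two legs for [i = 0] and [i = 2].                                *)
Definition step (i : 'I_3) z : alcove :=
  let: (r, s, a, b) := z in
  if i == 1%N :> nat then
    (if a == b then (r + (2 * Z_of_bool a - 1), s, ~~ a, ~~ b)
     else (r, s + (2 * Z_of_bool a - 1), ~~ a, ~~ b))
  else if Z.even (r + s) == (i == 0%N :> nat) then (r, s, ~~ a, b)
  else (r, s, a, ~~ b).

Lemma stepK i : involutive (step i).
Proof.
case=> [[[r s] a] b]; rewrite /step.
case: (i == 1%N :> nat); first by case: a; case: b => /=; congr (_, _, _, _); lia.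
by case eo: (_ == _) => /=; rewrite eo negbK.
Qed.

(** Each coordinate counts parallel lines, so this is the number of lines of the arrangement
    separating [u] from [v]. *)
Definition adist u v : Z :=
  Z.abs (cP u - cP v) + Z.abs (cQ u - cQ v) +
  Z.abs (cR u - cR v) + Z.abs (cS u - cS v).

Lemma adist_step i z : adist z (step i z) = 1.
Proof.
case: z => [[[r s] a] b]; rewrite /adist /step.
case: (i == 1%N :> nat); first by case: a; case: b => /=; lia.
by case eo: (_ == _) => /=; case: a; case: b => /=; lia.
Qed.

Lemma adist_triangle v u w : adist u w <= adist u v + adist v w.
Proof. rewrite /adist; lia. Qed.

Lemma adistC u v : adist u v = adist v u.
Proof. rewrite /adist; lia. Qed.

Lemma adist_ge0 u v : 0 <= adist u v.
Proof. rewrite /adist; lia. Qed.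

Lemma adist_eq0 u v : adist u v = 0 -> u = v.
Proof. by rewrite /adist => d0; apply: coords_inj; lia. Qed.

(** An alcove is the intersection of the half-planes cut out by its three walls, so some wall of [u]
    separates it from [v]; crossing that wall crosses no other line. *)
Lemma descent u v : u <> v -> exists i, adist (step i u) v = adist u v - 1.
Proof.
move=> neq_uv.
have flip_a : exists i : 'I_3,
    let: (r, s, a, b) := u in step i u = (r, s, ~~ a, b).
  case: u {neq_uv} => [[[r s] a] b]; case ev: (Z.even (r + s)).
    by exists c2_index0; rewrite /step /= ev.
  by exists c2_index2; rewrite /step /= ev.
have flip_b : exists i : 'I_3,
    let: (r, s, a, b) := u in step i u = (r, s, a, ~~ b).
  case: u {neq_uv flip_a} => [[[r s] a] b]; case ev: (Z.even (r + s)).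
    by exists c2_index2; rewrite /step /= ev.
  by exists c2_index0; rewrite /step /= ev.
have d0 : adist u v <> 0 by move/adist_eq0.
case: u v {neq_uv} flip_a flip_b d0
  => [[[r s] a] b] [[[r' s'] a'] b'] [i ia] [j jb].
set u := (r, s, a, b); set v := (r', s', a', b') => d0.
have [//|na] := Z.eq_dec (adist (step i u) v) (adist u v - 1); first by exists i.
have [//|nb] := Z.eq_dec (adist (step j u) v) (adist u v - 1); first by exists j.
exists c2_index1; move: d0 na nb; rewrite /u ia jb /v /step /adist /=.
case: a {u ia jb} => /=; case: b => /=; case: a' {v} => /=; case: b' => /=;
  lia.
Qed.

(** * Intervals and three-point boxes in the coordinates *)

Definition betweenZ (x y t : Z) := (Z.min x y <=? t) && (t <=? Z.max x y).
Definition between v u h :=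
  [&& betweenZ (cP v) (cP u) (cP h), betweenZ (cQ v) (cQ u) (cQ h),
      betweenZ (cR v) (cR u) (cR h) & betweenZ (cS v) (cS u) (cS h)].
Definition betweenZ3 (x y z t : Z) :=
  (Z.min x (Z.min y z) <=? t) && (t <=? Z.max x (Z.max y z)).
Definition between3 u v w h :=
  [&& betweenZ3 (cP u) (cP v) (cP w) (cP h),
      betweenZ3 (cQ u) (cQ v) (cQ w) (cQ h),
      betweenZ3 (cR u) (cR v) (cR w) (cR h) &
      betweenZ3 (cS u) (cS v) (cS w) (cS h)].

Lemma betweenZ3_xx x y t : betweenZ3 x x y t = betweenZ x y t.
Proof. by rewrite /betweenZ3 /betweenZ; lia. Qed.

(** The triangle inequality holds in each coordinate separately, so equality of the sums forces
    equality in all four. *)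
Lemma betweenP v u h : between v u h <-> adist v h + adist h u = adist v u.
Proof.
have coord x y t :
    betweenZ x y t = true /\ Z.abs (x - t) + Z.abs (t - y) = Z.abs (x - y) \/
    betweenZ x y t = false /\ Z.abs (x - y) < Z.abs (x - t) + Z.abs (t - y).
  by rewrite /betweenZ; lia.
rewrite /adist /between.
case: (coord (cP v) (cP u) (cP h)) => -[-> ep];
case: (coord (cQ v) (cQ u) (cQ h)) => -[-> eq];
case: (coord (cR v) (cR u) (cR h)) => -[-> er];
case: (coord (cS v) (cS u) (cS h)) => -[-> es];
move: ep eq er es; do 12![move: (Z.abs _) => ?]; split=> //=; lia.
Qed.

Lemma between_sym v u h : between v u h = between u v h.
Proof.
have coord x y t : betweenZ x y t = betweenZ y x t.
  by rewrite /betweenZ Z.min_comm Z.max_comm.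
by rewrite /between (coord (cP v)) (coord (cQ v)) (coord (cR v)) (coord (cS v)).
Qed.

Lemma between_end v u : between v u u.
Proof. by rewrite /between /betweenZ; apply/and4P; split; lia. Qed.

Lemma between3_convex u v w g g' h :
    between3 u v w g -> between3 u v w g' ->
    adist g h + adist h g' = adist g g' ->
  between3 u v w h.
Proof.
have coord (x y z a b t : Z) : betweenZ3 x y z a -> betweenZ3 x y z b ->
    betweenZ a b t -> betweenZ3 x y z t.
  by rewrite /betweenZ /betweenZ3; lia.
move=> /and4P[gp gq gr gs] /and4P[g'p g'q g'r g's] /betweenP/and4P[hp hq hr hs].
apply/and4P; split; [exact: coord gp g'p hp | exact: coord gq g'q hq |
  exact: coord gr g'r hr | exact: coord gs g's hs].
Qed.

Lemma between3_id u v w :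
  [&& between3 u v w u, between3 u v w v & between3 u v w w].
Proof. by apply/and3P; split; apply/and4P; split; rewrite /betweenZ3; lia. Qed.

Definition zrange (m n : Z) : seq Z :=
  [seq m + Z.of_nat i | i <- iota 0 (Z.to_nat (n + 1 - m))].

Lemma size_zrange m n : size (zrange m n) = Z.to_nat (n + 1 - m).
Proof. by rewrite size_map size_iota. Qed.

Lemma mem_zrange m n x : (x \in zrange m n) = (m <=? x) && (x <=? n).
Proof.
apply/mapP/idP => [[i]|xmn]; first by rewrite mem_iota => ? ->; lia.
by exists (Z.to_nat (x - m)); rewrite ?mem_iota; lia.
Qed.

Lemma zrange_uniq m n : uniq (zrange m n).
Proof. by rewrite map_inj_uniq ?iota_uniq // => i j; lia. Qed.

Definition bits : seq (bool * bool) :=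
  [:: (false, false); (false, true); (true, false); (true, true)].

Lemma mem_bits x : x \in bits.
Proof. by case: x => [] [] []. Qed.

Definition grid (bs : seq (bool * bool)) (xs ys : seq Z) :
    seq (Z * Z * (bool * bool)) :=
  [seq (x, ab) | x <- [seq (x, y) | x <- xs, y <- ys], ab <- bs].

Lemma size_grid bs xs ys :
  size (grid bs xs ys) = (size bs * (size xs * size ys))%nat.
Proof. by rewrite !size_allpairs mulnC. Qed.

Lemma grid_uniq bs xs ys : uniq bs -> uniq xs -> uniq ys -> uniq (grid bs xs ys).
Proof.
move=> bu xu yu; apply: allpairs_uniq => // [|[? ?] [? ?] _ _ [-> ->] //].
by apply: allpairs_uniq => // -[? ?] [? ?] _ _ [-> ->].
Qed.

Lemma mem_grid bs xs ys x y ab :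
  ((x, y, ab) \in grid bs xs ys) = [&& x \in xs, y \in ys & ab \in bs].
Proof.
apply/allpairsP/and3P => [[[? ?] /= [/allpairsP[? [? ? ->]] ? [-> -> ->]]] //|].
case=> ? ? ?; exists ((x, y), ab); split=> //=.
by apply/allpairsP; exists (x, y).
Qed.

Definition alcoves_in (m n m' n' : Z) : seq alcove :=
  [seq (x.1.1, x.1.2, x.2.1, x.2.2) | x <- grid bits (zrange m n) (zrange m' n')].

Lemma mem_alcoves_in m n m' n' h :
  (h \in alcoves_in m n m' n') =
  [&& m <=? cR h, cR h <=? n, m' <=? cS h & cS h <=? n'].
Proof.
case: h => [[[r s] a] b].
rewrite /alcoves_in.
set f := fun x : Z * Z * (bool * bool) => _.
have -> : (r, s, a, b) = f (r, s, (a, b)) by [].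
rewrite mem_map; last first.
  by move=> [[? ?] [? ?]] [[? ?] [? ?]] [-> -> -> ->].
by rewrite mem_grid !mem_zrange mem_bits /= andbT -!andbA.
Qed.

Lemma alcoves_in_uniq m n m' n' : uniq (alcoves_in m n m' n').
Proof.
rewrite map_inj_uniq ?grid_uniq ?zrange_uniq //.
by move=> [[? ?] [? ?]] [[? ?] [? ?]] [-> -> -> ->].
Qed.

Definition interval v u : seq alcove :=
  [seq h <- alcoves_in (Z.min (cR v) (cR u)) (Z.max (cR v) (cR u))
                       (Z.min (cS v) (cS u)) (Z.max (cS v) (cS u))
   | between v u h].

Lemma mem_interval v u h : (h \in interval v u) = between v u h.
Proof.
rewrite mem_filter mem_alcoves_in; case hb: (between v u h) => //=.
by case/and4P: hb => _ _; rewrite /betweenZ; lia.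
Qed.

Lemma interval_uniq v u : uniq (interval v u).
Proof. exact/filter_uniq/alcoves_in_uniq. Qed.

Definition hull3 u v w : seq alcove :=
  [seq h <- alcoves_in
      (Z.min (cR u) (Z.min (cR v) (cR w))) (Z.max (cR u) (Z.max (cR v) (cR w)))
      (Z.min (cS u) (Z.min (cS v) (cS w))) (Z.max (cS u) (Z.max (cS v) (cS w)))
   | between3 u v w h].

Lemma mem_hull3 u v w h : (h \in hull3 u v w) = between3 u v w h.
Proof.
rewrite mem_filter mem_alcoves_in; case h3: (between3 u v w h) => //=.
by case/and4P: h3 => _ _; rewrite /betweenZ3; lia.
Qed.

Lemma hull3_uniq u v w : uniq (hull3 u v w).
Proof. exact/filter_uniq/alcoves_in_uniq. Qed.

Lemma size_intervalC v u : size (interval v u) = size (interval u v).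
Proof.
apply/perm_size/uniq_perm; rewrite ?interval_uniq // => h.
by rewrite !mem_interval between_sym.
Qed.

Lemma interval_length_xx v : 1 + adist v v <= Z.of_nat (size (interval v v)).
Proof.
have : v \in interval v v by rewrite mem_interval between_end.
rewrite /adist !Z.sub_diag; case: interval => // h s _.
by rewrite [size _]/=; lia.
Qed.

(** The interval contains a geodesic: [interval v (step i u)] lies in [interval v u] and misses [u],
    so each step of a descent towards [v] accounts for one more alcove. *)
Lemma interval_length v u : 1 + adist v u <= Z.of_nat (size (interval v u)).
Proof.
have [n] : exists n, (Z.to_nat (adist u v) <= n)%nat.
  by exists (Z.to_nat (adist u v)).
elim: n u => [|n IH] u dn.
  have -> : v = u; last exact: interval_length_xx.
  by apply: adist_eq0; rewrite adistC; have := @adist_ge0 u v; lia.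
have [->|uv] := eqVneq u v; first exact: interval_length_xx.
have [i di] := descent (elimN eqP uv).
have IHi := IH (step i u) ltac:(lia).
have d1 : adist (step i u) u = 1 by rewrite adistC adist_step.
have u_out : u \notin interval v (step i u).
  rewrite mem_interval; apply/negP => /betweenP.
  have := adistC v u; have := adistC v (step i u).
  have := adistC u (step i u); lia.
have sub : {subset u :: interval v (step i u) <= interval v u}.
  move=> h; rewrite inE => /predU1P[->|]; rewrite !mem_interval.
    exact: between_end.
  move=> /betweenP hb; apply/betweenP.
  have := @adist_triangle h v u; have := @adist_triangle (step i u) h u.
  have := adistC u v; have := adistC (step i u) v; lia.
have : (size (u :: interval v (step i u)) <= size (interval v u))%nat.
  by apply: uniq_leq_size sub; rewrite cons_uniq u_out interval_uniq.
rewrite [size (_ :: _)]/= => lt_sz.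
have := adistC v u; have := adistC v (step i u); lia.
Qed.

(** * Counting alcoves *)

Lemma eqZE (x y : Z) : (x == y) = (x =? y).
Proof. by apply/eqP/idP; lia. Qed.

(* Of the parallelogram spanned by v and u in the coordinates Q and S, only    *)
(* these alcoves near v and near u may fail to lie between v and u.            *)
Definition lower_loss v : seq alcove :=
  let: (r, s, a, b) := v in
  match a, b with
  | false, false => [:: (r - 1, s, false, true); (r - 1, s, true, true)]
  | true, false => [:: (r, s, false, false); (r - 1, s, false, true);
                       (r - 1, s, true, true); (r, s, false, true)]
  | true, true => [:: (r, s, false, true)]
  | false, true => [::]
  end.

Definition upper_loss u : seq alcove :=
  let: (r, s, a, b) := u in
  match a, b with
  | true, true => [:: (r + 1, s, true, false); (r + 1, s, false, false)]
  | false, true => [:: (r, s, true, true); (r + 1, s, true, false);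
                       (r + 1, s, false, false); (r, s, true, false)]
  | false, false => [:: (r, s, true, false)]
  | true, false => [::]
  end.

(** Inverts Q = r - s - 1 + b: four alcoves, one for each choice of sides, share given values of Q
    and S. *)
Definition QS_alcove (x : Z * Z * (bool * bool)) : alcove :=
  (x.1.1 + x.1.2 + 1 - Z_of_bool x.2.2, x.1.2, x.2.1, x.2.2).

(** Since P = Q + 2 S + 1 + a - b and R = Q + S + 1 - b, the bounds on Q and S imply those on P and
    R except for the contribution of the bits, which matters only in the corners at [v] and [u]. *)
Lemma mem_loss v u x :
    cQ v <= x.1.1 <= cQ u -> cS v <= x.1.2 <= cS u ->
    ~~ between v u (QS_alcove x) ->
  QS_alcove x \in lower_loss v ++ upper_loss u.
Proof.
case: v u x => [[[r s] a] b] [[[r' s'] a'] b'] [[q t] [c d]].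
rewrite /QS_alcove /= => qb tb; rewrite /between /betweenZ /=.
case: a b a' b' c d qb => [] [] [] [] [] [] /= qb;
  rewrite ?inE /= ?xpair_eqE ?eqxx ?andbT ?andbF /= ?orbF ?eqZE; lia.
Qed.

Lemma interval_area v u : cQ v <= cQ u -> cS v <= cS u ->
  4 * (cQ u - cQ v + 1) * (cS u - cS v + 1) -
    Z.of_nat (size (lower_loss v) + size (upper_loss u)) <=
  Z.of_nat (size (interval v u)).
Proof.
move=> Qvu Svu.
pose G := grid bits (zrange (cQ v) (cQ u)) (zrange (cS v) (cS u)).
have uG : uniq (map QS_alcove G).
  rewrite map_inj_uniq ?grid_uniq ?zrange_uniq //.
  move=> [[q s] [a b]] [[q' s'] [a' b']] [+ es ea eb]; rewrite /= es ea eb => eqr.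
  by have -> : q = q' by lia.
have szG : size (map QS_alcove G) =
    (4 * (Z.to_nat (cQ u + 1 - cQ v) * Z.to_nat (cS u + 1 - cS v)))%nat.
  by rewrite size_map size_grid !size_zrange.
have le_in : (size (filter (between v u) (map QS_alcove G)) <=
    size (interval v u))%nat.
  apply: uniq_leq_size; first exact: filter_uniq.
  by move=> h; rewrite mem_filter mem_interval => /andP[].
have le_out : (size (filter (predC (between v u)) (map QS_alcove G)) <=
    size (lower_loss v ++ upper_loss u))%nat.
  apply: uniq_leq_size; first exact: filter_uniq.
  move=> h; rewrite mem_filter => /andP[/= out /mapP[[[q s] ab] + hE]].
  rewrite hE in out *; rewrite mem_grid !mem_zrange => /and3P[Qx Sx _].
  by apply: mem_loss => //=; lia.
have := count_predC (between v u) (map QS_alcove G).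
rewrite -!size_filter szG; rewrite size_cat in le_out; nia.
Qed.

(** * Standard position of an interval up to symmetry *)

Definition dP v u := Z.abs (cP v - cP u).
Definition dQ v u := Z.abs (cQ v - cQ u).
Definition dR v u := Z.abs (cR v - cR u).
Definition dS v u := Z.abs (cS v - cS u).

(** Records what remains of standard position after a symmetry of the tiling: [t1] exchanges the
    roles of P and Q, [t2] those of R and S. *)
Definition shaped v u (t1 t2 : bool) := exists E b d,
  [/\ E \in loss_table, 0 <= b /\ 0 <= d,
      (dP v u, dQ v u) =
        (if t1 then (b, b + 2 * d + E.1.1) else (b + 2 * d + E.1.1, b)),
      (dR v u, dS v u) =
        (if t2 then (d, b + d + E.1.2) else (b + d + E.1.2, d)) &
      4 * (b + 1) * (d + 1) - E.2 <= Z.of_nat (size (interval v u))].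

(** The differences of the bits give exactly the nine keys of [loss_table], so the default of [nth]
    is never reached. *)
Definition loss_entry a b a' b' : Z * Z * Z :=
  let m := (Z_of_bool a' - Z_of_bool a - (Z_of_bool b' - Z_of_bool b),
            Z_of_bool b - Z_of_bool b') in
  (m, seq.nth 0 [seq x.2 | x <- loss_table]
        (index m [seq x.1 | x <- loss_table])).

Lemma loss_entryP a b a' b' (E := loss_entry a b a' b') :
  [&& E \in loss_table,
      E.1.1 == Z_of_bool a' - Z_of_bool a - (Z_of_bool b' - Z_of_bool b),
      E.1.2 == Z_of_bool b - Z_of_bool b' &
      Z.of_nat (size (lower_loss (0, 0, a, b)) +
                size (upper_loss (0, 0, a', b'))) <=? E.2].
Proof. by rewrite {}/E; case: a; case: b; case: a'; case: b'. Qed.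

Lemma shaped_std v u :
    cP v <= cP u -> cQ v <= cQ u -> cR v <= cR u -> cS v <= cS u ->
  shaped v u false false.
Proof.
move=> Pvu Qvu Rvu Svu; have := interval_area Qvu Svu.
set n := Z.of_nat (size (interval v u)) => area.
have [E [Ein EP ER El]] : exists E, [/\ E \in loss_table,
   cP u - cP v = cQ u - cQ v + 2 * (cS u - cS v) + E.1.1,
   cR u - cR v = cQ u - cQ v + (cS u - cS v) + E.1.2 &
   Z.of_nat (size (lower_loss v) + size (upper_loss u)) <= E.2].
  case: v u {n area Pvu Qvu Rvu Svu} => [[[r s] a] b] [[[r' s'] a'] b'].
  exists (loss_entry a b a' b').
  have /and4P[Ein /eqP-> /eqP->] := loss_entryP a b a' b'.
  have -> : size (lower_loss (r, s, a, b)) = size (lower_loss (0, 0, a, b)).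
    by case: (a); case: (b).
  have -> : size (upper_loss (r', s', a', b')) = size (upper_loss (0, 0, a', b')).
    by case: (a'); case: (b').
  by rewrite /= => El; split=> //; lia.
exists E, (cQ u - cQ v), (cS u - cS v); split=> //; first lia.
- by congr (_, _); rewrite /dP /dQ; lia.
- by congr (_, _); rewrite /dR /dS; lia.
- by rewrite -/n; lia.
Qed.

(* The reflections in the lines x = y and x = 0.                               *)
Definition flipS z : alcove :=
  let: (r, s, a, b) := z in (r, -1 - s, b, a).
Definition flipP z : alcove :=
  let: (r, s, a, b) := z in (-1 - s, -1 - r, ~~ a, b).

Lemma flipS_coords z : [/\ cP (flipS z) = cQ z, cQ (flipS z) = cP z,
  cR (flipS z) = cR z & cS (flipS z) = -1 - cS z].
Proof. by case: z => [[[r s] a] b]; split=> //=; lia. Qed.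

Lemma flipP_coords z : [/\ cP (flipP z) = -1 - cP z, cQ (flipP z) = cQ z,
  cR (flipP z) = -1 - cS z & cS (flipP z) = -1 - cR z].
Proof. by case: z => [[[r s] a] b]; split=> //=; case: a; case: b => /=; lia. Qed.

Lemma flipSK : involutive flipS.
Proof. by case=> [[[r s] a] b] /=; congr (_, _, _, _); lia. Qed.

Lemma flipPK : involutive flipP.
Proof. by case=> [[[r s] a] b] /=; rewrite negbK; congr (_, _, _, _); lia. Qed.

Lemma leq_size_interval f v u : injective f ->
  (forall h, between v u h -> between (f v) (f u) (f h)) ->
  (size (interval v u) <= size (interval (f v) (f u)))%nat.
Proof.
move=> f_inj btw_f; rewrite -(size_map f); apply: uniq_leq_size.
  by rewrite map_inj_uniq ?interval_uniq.
by move=> _ /mapP[h + ->]; rewrite !mem_interval; apply: btw_f.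
Qed.

Lemma betweenZN x y t : betweenZ x y t -> betweenZ (-1 - x) (-1 - y) (-1 - t).
Proof. by rewrite /betweenZ; lia. Qed.

Lemma between_flipS v u h :
  between v u h -> between (flipS v) (flipS u) (flipS h).
Proof.
rewrite /between.
have [-> -> -> ->] := flipS_coords v; have [-> -> -> ->] := flipS_coords u.
have [-> -> -> ->] := flipS_coords h.
by case/and4P=> p q r s; rewrite p q r betweenZN.
Qed.

Lemma between_flipP v u h :
  between v u h -> between (flipP v) (flipP u) (flipP h).
Proof.
rewrite /between.
have [-> -> -> ->] := flipP_coords v; have [-> -> -> ->] := flipP_coords u.
have [-> -> -> ->] := flipP_coords h.
by case/and4P=> p q r s; rewrite q !betweenZN.
Qed.

Lemma shaped_flipS v u t1 t2 :
  shaped (flipS v) (flipS u) t1 t2 -> shaped v u (~~ t1) t2.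
Proof.
case=> E [b [d [Ein bd eqPQ eqRS area]]]; exists E, b, d.
have := leq_size_interval (can_inj flipSK) (@between_flipS (flipS v) (flipS u)).
rewrite !flipSK => le_size; move: eqPQ eqRS; rewrite /dP /dQ /dR /dS.
have [-> -> -> ->] := flipS_coords v; have [-> -> -> ->] := flipS_coords u.
move=> eqPQ eqRS; split=> //; last lia.
- by case: t1 eqPQ => -[-> ->].
- by rewrite -eqRS; congr (_, _); lia.
Qed.

Lemma shaped_flipP v u t1 t2 :
  shaped (flipP v) (flipP u) t1 t2 -> shaped v u t1 (~~ t2).
Proof.
case=> E [b [d [Ein bd eqPQ eqRS area]]]; exists E, b, d.
have := leq_size_interval (can_inj flipPK) (@between_flipP (flipP v) (flipP u)).
rewrite !flipPK => le_size; move: eqPQ eqRS; rewrite /dP /dQ /dR /dS.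
have [-> -> -> ->] := flipP_coords v; have [-> -> -> ->] := flipP_coords u.
have flip x y : Z.abs (-1 - x - (-1 - y)) = Z.abs (x - y) by lia.
rewrite !flip => eqPQ eqRS; split=> //; last lia.
by case: t2 eqRS => -[-> ->].
Qed.

Lemma shaped_sym v u t1 t2 : shaped v u t1 t2 -> shaped u v t1 t2.
Proof.
have abs_sym x y : Z.abs (x - y) = Z.abs (y - x) by lia.
case=> E [b [d [Ein bd eqPQ eqRS area]]]; exists E, b, d.
rewrite size_intervalC /dP /dQ /dR /dS; split=> //.
- by rewrite -eqPQ /dP /dQ abs_sym (abs_sym (cQ u)).
- by rewrite -eqRS /dR /dS abs_sym (abs_sym (cS u)).
Qed.

(** The constraints that tie together the integral parts of x, y, (x + y) / 2 and (x - y) / 2 at one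
    point. *)
Definition coherent (p q r s : Z) :=
  p + q - 1 <= 2 * r <= p + q + 1 /\ p - q - 2 <= 2 * s <= p - q.

Lemma coords_rel z : coherent (cP z) (cQ z) (cR z) (cS z).
Proof.
by case: z => [[[r s] a] b]; rewrite /coherent; case: a; case: b => /=; lia.
Qed.

Lemma shaped_up v u :
  cP v <= cP u -> cQ v <= cQ u -> exists t1 t2, shaped v u t1 t2.
Proof.
move=> Pvu Qvu; have := coords_rel v; have := coords_rel u.
rewrite /coherent => relu relv.
have [Rvu|Ruv] := Z.le_gt_cases (cR v) (cR u); last first.
  (* If R decreases while P and Q do not, coherence forces P and Q to agree, and then S by parity;
     the reversed pair is standard. *)
  by exists false, false; apply/shaped_sym/shaped_std; lia.
have [Svu|Suv] := Z.le_gt_cases (cS v) (cS u).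
  by exists false, false; apply: shaped_std.
exists true, false; apply: (@shaped_flipS _ _ false).
have [pv qv rv sv] := flipS_coords v; have [pu qu ru su] := flipS_coords u.
apply: shaped_std; lia.
Qed.

Lemma shapedP v u : exists t1 t2, shaped v u t1 t2.
Proof.
wlog Pvu : v u / cP v <= cP u => [wlogP|].
  have [/wlogP//|/Z.lt_le_incl/wlogP[t1 [t2 sh]]] := Z.le_gt_cases (cP v) (cP u).
  by exists t1, t2; apply: shaped_sym.
have [/(shaped_up Pvu)//|Quv] := Z.le_gt_cases (cQ v) (cQ u).
have [||t1 [t2 sh]] := @shaped_up (flipP u) (flipP v).
- by have [-> _ _ _] := flipP_coords v; have [-> _ _ _] := flipP_coords u; lia.
- by have [_ -> _ _] := flipP_coords v; have [_ -> _ _] := flipP_coords u; lia.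
by exists t1, (~~ t2); apply/shaped_flipP/shaped_sym.
Qed.

Definition some_area_le (p q r s n : Z) :=
  [\/ 2 * p * q <= n, 4 * r * s <= n |
   [\/ 4 * p * r <= n, 4 * p * s <= n, 4 * q * r <= n | 4 * q * s <= n]].

Lemma some_area_le_swapPQ p q r s n :
  some_area_le p q r s n -> some_area_le q p r s n.
Proof.
case=> [le|le|[le|le|le|le]]; [apply: Or31; lia|exact: Or32|..]; apply: Or33;
  by [exact: Or41|exact: Or42|exact: Or43|exact: Or44].
Qed.

Lemma some_area_le_swapRS p q r s n :
  some_area_le p q r s n -> some_area_le p q s r n.
Proof.
case=> [le|le|[le|le|le|le]]; [exact: Or31|apply: Or32; lia|..]; apply: Or33;
  by [exact: Or41|exact: Or42|exact: Or43|exact: Or44].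
Qed.

(** The claim is symmetric under exchanging P with Q, or R with S, in both intervals at once. Only
    the relative positions [t1 (+) t1'] and [t2 (+) t2'] matter, so the interval from [v] to [u] may
    be taken standard. *)
Lemma interval_area_product v u w : 2 <= adist v u -> 2 <= adist v w ->
  some_area_le (1 + dP v u + dP v w) (1 + dQ v u + dQ v w)
    (1 + dR v u + dR v w) (1 + dS v u + dS v w)
    (Z.of_nat (size (interval v u)) * Z.of_nat (size (interval v w))).
Proof.
have [t1 [t2 sh]] := shapedP v u.
have [[[m1 m2] l] [b [d [Ein [b0 d0] eqPQ eqRS area]]]] := sh.
have [t1' [t2' sh']] := shapedP v w.
have [[[m1' m2'] l'] [b' [d' [E'in [b'0 d'0] eqPQ' eqRS' area']]]] := sh'.
have := @interval_length v u; have := @interval_length v w; move=> {sh sh'}.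
have dist x y : adist x y = dP x y + dQ x y + dR x y + dS x y by [].
have abs_ge0 x y : [/\ 0 <= dP x y, 0 <= dQ x y, 0 <= dR x y & 0 <= dS x y].
  by rewrite /dP /dQ /dR /dS; split; apply: Z.abs_nonneg.
rewrite !dist; move: (abs_ge0 v u) (abs_ge0 v w) eqPQ eqRS eqPQ' eqRS' area area'.
move: (dP v u) (dQ v u) (dR v u) (dS v u) => p q r s.
move: (dP v w) (dQ v w) (dR v w) (dS v w) => p' q' r' s'.
move: (Z.of_nat (size (interval v u))) => n.
move: (Z.of_nat (size (interval v w))) => n'.
move=> [p0 q0 r0 s0] [p'0 q'0 r'0 s'0] eqPQ eqRS eqPQ' eqRS' area area' len' len.
move=> dvu dvw; have std := @area_product_std (m1, m2, l) (m1', m2', l')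
  (t1 (+) t1') (t2 (+) t2') b d b' d' n n' Ein E'in b0 d0 b'0 d'0.
rewrite /= in std eqPQ eqRS eqPQ' eqRS' area area'.
case: t1 t1' t2 t2' std eqPQ eqRS eqPQ' eqRS' => [] [] [] [] /= std [? ?] [? ?];
  case=> ? ? [? ?]; subst.
all: have {}std := std ltac:(lia) ltac:(lia) ltac:(lia) ltac:(lia) ltac:(lia)
  ltac:(lia) ltac:(lia) ltac:(lia) ltac:(lia) ltac:(lia).
all: first [exact: std | exact: some_area_le_swapPQ | exact: some_area_le_swapRS |
  exact/some_area_le_swapPQ/some_area_le_swapRS].
Qed.

(** * Upper bounds for the box *)

Lemma size_hull3_le (c c' : alcove -> Z) (lab : alcove -> bool * bool)
    (bs : seq (bool * bool)) u v w :
    injective (fun h => (c h, c' h, lab h)) ->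
    (forall h, lab h \in bs) -> uniq bs ->
    (forall h, between3 u v w h -> betweenZ3 (c u) (c v) (c w) (c h)) ->
    (forall h, between3 u v w h -> betweenZ3 (c' u) (c' v) (c' w) (c' h)) ->
  Z.of_nat (size (hull3 u v w)) <= Z.of_nat (size bs) *
    (1 + Z.abs (c v - c u) + Z.abs (c v - c w)) *
    (1 + Z.abs (c' v - c' u) + Z.abs (c' v - c' w)).
Proof.
move=> f_inj labP bs_uniq btwc btwc'.
pose lo c0 : Z := Z.min (c0 u) (Z.min (c0 v) (c0 w)).
pose hi c0 : Z := Z.max (c0 u) (Z.max (c0 v) (c0 w)).
have : (size (hull3 u v w) <=
    size (grid bs (zrange (lo c) (hi c)) (zrange (lo c') (hi c'))))%nat.
  rewrite -(size_map (fun h => (c h, c' h, lab h))); apply: uniq_leq_size.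
    by rewrite map_inj_uniq ?hull3_uniq.
  move=> _ /mapP[h + ->]; rewrite mem_hull3 mem_grid !mem_zrange labP andbT => h3.
  by apply/andP; split; [apply: btwc|apply: btwc'].
rewrite size_grid !size_zrange => le_size.
have width c0 : 0 <= hi c0 + 1 - lo c0 <=
    1 + Z.abs (c0 v - c0 u) + Z.abs (c0 v - c0 w).
  by rewrite /hi /lo; lia.
have [w0 w1] := width c; have [w'0 w'1] := width c'.
have le_prod : (hi c + 1 - lo c) * (hi c' + 1 - lo c') <=
    (1 + Z.abs (c v - c u) + Z.abs (c v - c w)) *
    (1 + Z.abs (c' v - c' u) + Z.abs (c' v - c' w)).
  exact: Z.mul_le_mono_nonneg.
rewrite -Z.mul_assoc.
apply: Z.le_trans (_ : Z.of_nat (size bs) *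
  ((hi c + 1 - lo c) * (hi c' + 1 - lo c')) <= _).
  rewrite -(Z2Nat.id _ w0) -(Z2Nat.id _ w'0).
  rewrite -!Nat2Z.inj_mul; apply/inj_le/leP; exact: le_size.
by apply: Z.mul_le_mono_nonneg_l => //; lia.
Qed.

(** A unit square of the P, Q grid is cut by one diagonal into two alcoves; every other pair of
    coordinate strips meets in a parallelogram made of four. Hence the factors 2 and 4. *)
Lemma hull3_area v u w n :
    some_area_le (1 + dP v u + dP v w) (1 + dQ v u + dQ v w)
      (1 + dR v u + dR v w) (1 + dS v u + dS v w) n ->
  Z.of_nat (size (hull3 u v w)) <= n.
Proof.
pose bitsP := [:: (false, false); (true, false)].
have inj_by (c c' : alcove -> Z) lab :
    (forall g h, c g = c h -> c' g = c' h -> lab g = lab h ->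
       [/\ cP g = cP h, cQ g = cQ h, cR g = cR h & cS g = cS h]) ->
    injective (fun h => (c h, c' h, lab h)).
  by move=> H g h [e e' el]; have [] := H _ _ e e' el; apply: coords_inj.
pose lab (h : alcove) := (h.1.2, h.2); pose labP (h : alcove) := (h.1.2, false).
pose within c := forall h, between3 u v w h -> betweenZ3 (c u) (c v) (c w) (c h).
have [btwP btwQ] : within cP /\ within cQ by split=> h /and4P[].
have [btwR btwS] : within cR /\ within cS by split=> h /and4P[].
have in_bits h : lab h \in bits by apply: mem_bits.
have uniq_bits : uniq bits by [].
have bound c c' k := @size_hull3_le c c' lab bits u v w k in_bits uniq_bits.
case=> [le|le|[le|le|le|le]]; apply: Z.le_trans le.
- apply: (@size_hull3_le cP cQ labP bitsP) => //; last first.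
    by move=> h; rewrite /labP; case: h.1.2.
  (* Once P, Q and a are known, b is determined by a parity condition. *)
  apply: inj_by => -[[[r s] a] b] -[[[r' s'] a'] b'] /= + + [ea]; rewrite ea.
  by case: b; case: b' => /=; split; lia.
- apply: (bound cR cS) => //; apply: inj_by => -[[[r s] a] b] -[[[r' s'] a'] b'].
  by move=> /= + + [ea eb]; rewrite ea eb; split; lia.
- apply: (bound cP cR) => //; apply: inj_by => -[[[r s] a] b] -[[[r' s'] a'] b'].
  by move=> /= + + [ea eb]; rewrite ea eb; split; lia.
- apply: (bound cP cS) => //; apply: inj_by => -[[[r s] a] b] -[[[r' s'] a'] b'].
  by move=> /= + + [ea eb]; rewrite ea eb; split; lia.
- apply: (bound cQ cR) => //; apply: inj_by => -[[[r s] a] b] -[[[r' s'] a'] b'].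
  by move=> /= + + [ea eb]; rewrite ea eb; split; lia.
- apply: (bound cQ cS) => //; apply: inj_by => -[[[r s] a] b] -[[[r' s'] a'] b'].
  by move=> /= + + [ea eb]; rewrite ea eb; split; lia.
Qed.

(** * Folding the box across a wall of [v] *)

Lemma hull3_fold f u v w : injective f ->
  (forall h, between3 u v w h -> ~~ between v w h -> between v w (f h)) ->
  (size (hull3 u v w) <= 2 * size (interval v w))%nat.
Proof.
move=> f_inj fold; pose H := hull3 u v w.
have := count_predC (between v w) H; rewrite -!size_filter => <-.
rewrite mul2n -addnn leq_add //.
  apply: uniq_leq_size => [|h]; first exact/filter_uniq/hull3_uniq.
  by rewrite mem_filter mem_interval => /andP[].
rewrite -(size_map f); apply: uniq_leq_size => [|_ /mapP[h + ->]].
  by rewrite map_inj_uniq //; exact/filter_uniq/hull3_uniq.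
by rewrite mem_filter mem_hull3 mem_interval => /andP[/= ? ?]; apply: fold.
Qed.

(* The reflections in the lines x = k, y = k, x + y = 2k and x - y = 2k.       *)
Definition reflP k z : alcove :=
  let: (r, s, a, b) := z in (k - 1 - s, k - 1 - r, ~~ a, b).
Definition reflQ k z : alcove :=
  let: (r, s, a, b) := z in (s + k, r - k, a, ~~ b).
Definition reflR k z : alcove :=
  let: (r, s, a, b) := z in (2 * k - 1 - r, s, ~~ b, ~~ a).
Definition reflS k z : alcove :=
  let: (r, s, a, b) := z in (r, 2 * k - 1 - s, b, a).

Lemma reflP_coords k z :
  [/\ cP (reflP k z) = 2 * k - 1 - cP z, cQ (reflP k z) = cQ z,
      cR (reflP k z) = k - 1 - cS z & cS (reflP k z) = k - 1 - cR z].
Proof. by case: z => [[[r s] a] b]; split=> //=; case: a; case: b => /=; lia. Qed.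

Lemma reflQ_coords k z :
  [/\ cP (reflQ k z) = cP z, cQ (reflQ k z) = 2 * k - 1 - cQ z,
      cR (reflQ k z) = cS z + k & cS (reflQ k z) = cR z - k].
Proof. by case: z => [[[r s] a] b]; split=> //=; case: a; case: b => /=; lia. Qed.

Lemma reflR_coords k z :
  [/\ cP (reflR k z) = 2 * k - 1 - cQ z, cQ (reflR k z) = 2 * k - 1 - cP z,
      cR (reflR k z) = 2 * k - 1 - cR z & cS (reflR k z) = cS z].
Proof. by case: z => [[[r s] a] b]; split=> //=; case: a; case: b => /=; lia. Qed.

Lemma reflS_coords k z :
  [/\ cP (reflS k z) = 2 * k + cQ z, cQ (reflS k z) = cP z - 2 * k,
      cR (reflS k z) = cR z & cS (reflS k z) = 2 * k - 1 - cS z].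
Proof. by case: z => [[[r s] a] b]; split=> //=; case: a; case: b => /=; lia. Qed.

Lemma reflPK k : involutive (reflP k).
Proof. by case=> [[[r s] a] b] /=; rewrite negbK; congr (_, _, _, _); lia. Qed.

Lemma reflQK k : involutive (reflQ k).
Proof. by case=> [[[r s] a] b] /=; rewrite negbK; congr (_, _, _, _); lia. Qed.

Lemma reflRK k : involutive (reflR k).
Proof. by case=> [[[r s] a] b] /=; rewrite !negbK; congr (_, _, _, _); lia. Qed.

Lemma reflSK k : involutive (reflS k).
Proof. by case=> [[[r s] a] b] /=; congr (_, _, _, _); lia. Qed.

(** The hypotheses force [ph = pu]: the alcove lies in the strip just beyond the line x = k, and the
    reflection carries that strip to the one of [v]. The bounds on the other coordinates are linear
    consequences of coherence. The next three lemmas treat the other directions in the same way. *)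
Lemma foldP pv qv rv sv pw qw rw sw ph qh rh sh k pu :
    coherent pv qv rv sv -> coherent pw qw rw sw -> coherent ph qh rh sh ->
    Z.abs (pv - pu) = 1 -> k = Z.max pv pu -> coherent pu qv rv sv ->
    [&& betweenZ3 pu pv pw ph, betweenZ qv qw qh,
        betweenZ rv rw rh & betweenZ sv sw sh] ->
    ~~ betweenZ pv pw ph ->
  [&& betweenZ pv pw (2 * k - 1 - ph), betweenZ qv qw qh,
      betweenZ rv rw (k - 1 - sh) & betweenZ sv sw (k - 1 - rh)].
Proof.
rewrite /coherent => ? ? ? ? ? ? /and4P[bp bq br bs] nb.
apply/and4P; split; move: bp bq br bs nb; rewrite /betweenZ /betweenZ3; lia.
Qed.

Lemma foldQ pv qv rv sv pw qw rw sw ph qh rh sh k qu :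
    coherent pv qv rv sv -> coherent pw qw rw sw -> coherent ph qh rh sh ->
    Z.abs (qv - qu) = 1 -> k = Z.max qv qu -> coherent pv qu rv sv ->
    [&& betweenZ pv pw ph, betweenZ3 qu qv qw qh,
        betweenZ rv rw rh & betweenZ sv sw sh] ->
    ~~ betweenZ qv qw qh ->
  [&& betweenZ pv pw ph, betweenZ qv qw (2 * k - 1 - qh),
      betweenZ rv rw (sh + k) & betweenZ sv sw (rh - k)].
Proof.
rewrite /coherent => ? ? ? ? ? ? /and4P[bp bq br bs] nb.
apply/and4P; split; move: bp bq br bs nb; rewrite /betweenZ /betweenZ3; lia.
Qed.

Lemma foldR pv qv rv sv pw qw rw sw ph qh rh sh k ru :
    coherent pv qv rv sv -> coherent pw qw rw sw -> coherent ph qh rh sh ->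
    Z.abs (rv - ru) = 1 -> k = Z.max rv ru -> coherent pv qv ru sv ->
    [&& betweenZ pv pw ph, betweenZ qv qw qh,
        betweenZ3 ru rv rw rh & betweenZ sv sw sh] ->
    ~~ betweenZ rv rw rh ->
  [&& betweenZ pv pw (2 * k - 1 - qh), betweenZ qv qw (2 * k - 1 - ph),
      betweenZ rv rw (2 * k - 1 - rh) & betweenZ sv sw sh].
Proof.
rewrite /coherent => ? ? ? ? ? ? /and4P[bp bq br bs] nb.
apply/and4P; split; move: bp bq br bs nb; rewrite /betweenZ /betweenZ3; lia.
Qed.

Lemma foldS pv qv rv sv pw qw rw sw ph qh rh sh k su :
    coherent pv qv rv sv -> coherent pw qw rw sw -> coherent ph qh rh sh ->
    Z.abs (sv - su) = 1 -> k = Z.max sv su -> coherent pv qv rv su ->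
    [&& betweenZ pv pw ph, betweenZ qv qw qh,
        betweenZ rv rw rh & betweenZ3 su sv sw sh] ->
    ~~ betweenZ sv sw sh ->
  [&& betweenZ pv pw (2 * k + qh), betweenZ qv qw (ph - 2 * k),
      betweenZ rv rw rh & betweenZ sv sw (2 * k - 1 - sh)].
Proof.
rewrite /coherent => ? ? ? ? ? ? /and4P[bp bq br bs] nb.
apply/and4P; split; move: bp bq br bs nb; rewrite /betweenZ /betweenZ3; lia.
Qed.

Lemma size_hull3_adjacent u v w : adist v u = 1 ->
  (size (hull3 u v w) <= 2 * size (interval v w))%nat.
Proof.
have [[relu relv] relw] := (coords_rel u, coords_rel v, coords_rel w).
have cases (x y z t : Z) :
    0 <= x -> 0 <= y -> 0 <= z -> 0 <= t -> x + y + z + t = 1 ->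
  [\/ [/\ x = 1, y = 0, z = 0 & t = 0], [/\ x = 0, y = 1, z = 0 & t = 0],
      [/\ x = 0, y = 0, z = 1 & t = 0] | [/\ x = 0, y = 0, z = 0 & t = 1]].
  move=> x0 y0 z0 t0 e.
  have [x1|?] := Z.le_gt_cases x 0; last by apply: Or41; split; lia.
  have [y1|?] := Z.le_gt_cases y 0; last by apply: Or42; split; lia.
  have [z1|?] := Z.le_gt_cases z 0; last by apply: Or43; split; lia.
  by apply: Or44; split; lia.
have abs0 x y : Z.abs (x - y) = 0 -> y = x by lia.
have [dP0 dQ0 dR0 dS0] : [/\ 0 <= dP v u, 0 <= dQ v u, 0 <= dR v u & 0 <= dS v u].
  by rewrite /dP /dQ /dR /dS; split; apply: Z.abs_nonneg.
case/(cases _ _ _ _ dP0 dQ0 dR0 dS0) => -[hP hQ hR hS].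
- have [eQ eR eS] := And3 (abs0 _ _ hQ) (abs0 _ _ hR) (abs0 _ _ hS).
  rewrite eQ eR eS in relu; pose k := Z.max (cP v) (cP u).
  apply: (hull3_fold (can_inj (reflPK k))) => h; rewrite /between3 /between.
  have [-> -> -> ->] := reflP_coords k h; rewrite eQ eR eS !betweenZ3_xx => h3 nh.
  apply: (foldP relv relw (coords_rel h) hP erefl relu h3).
  by apply: contraNN nh => bP; case/and4P: h3 => *; apply/and4P.
- have [eP eR eS] := And3 (abs0 _ _ hP) (abs0 _ _ hR) (abs0 _ _ hS).
  rewrite eP eR eS in relu; pose k := Z.max (cQ v) (cQ u).
  apply: (hull3_fold (can_inj (reflQK k))) => h; rewrite /between3 /between.
  have [-> -> -> ->] := reflQ_coords k h; rewrite eP eR eS !betweenZ3_xx => h3 nh.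
  apply: (foldQ relv relw (coords_rel h) hQ erefl relu h3).
  by apply: contraNN nh => bQ; case/and4P: h3 => *; apply/and4P.
- have [eP eQ eS] := And3 (abs0 _ _ hP) (abs0 _ _ hQ) (abs0 _ _ hS).
  rewrite eP eQ eS in relu; pose k := Z.max (cR v) (cR u).
  apply: (hull3_fold (can_inj (reflRK k))) => h; rewrite /between3 /between.
  have [-> -> -> ->] := reflR_coords k h; rewrite eP eQ eS !betweenZ3_xx => h3 nh.
  apply: (foldR relv relw (coords_rel h) hR erefl relu h3).
  by apply: contraNN nh => bR; case/and4P: h3 => *; apply/and4P.
- have [eP eQ eR] := And3 (abs0 _ _ hP) (abs0 _ _ hQ) (abs0 _ _ hR).
  rewrite eP eQ eR in relu; pose k := Z.max (cS v) (cS u).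
  apply: (hull3_fold (can_inj (reflSK k))) => h; rewrite /between3 /between.
  have [-> -> -> ->] := reflS_coords k h; rewrite eP eQ eR !betweenZ3_xx => h3 nh.
  apply: (foldS relv relw (coords_rel h) hS erefl relu h3).
  by apply: contraNN nh => bS; case/and4P: h3 => *; apply/and4P.
Qed.

Lemma hull3_sym u v w : hull3 u v w =i hull3 w v u.
Proof.
have sym (x y z t : Z) : betweenZ3 x y z t = betweenZ3 z y x t.
  have min3 : Z.min x (Z.min y z) = Z.min z (Z.min y x) by lia.
  have max3 : Z.max x (Z.max y z) = Z.max z (Z.max y x) by lia.
  by rewrite /betweenZ3 min3 max3.
move=> h; rewrite !mem_hull3 /between3.
by rewrite (sym (cP u)) (sym (cQ u)) (sym (cR u)) (sym (cS u)).
Qed.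

Lemma size_hull3_le_mul u v w :
  (size (hull3 u v w) <= size (interval v u) * size (interval v w))%nat.
Proof.
have itv0 x : (0 < size (interval v x))%nat.
  by have := @interval_length v x; have := @adist_ge0 v x; lia.
have sym x y : size (hull3 x v y) = size (hull3 y v x).
  by apply/perm_size/uniq_perm; rewrite ?hull3_uniq //; apply: hull3_sym.
wlog dvuw : u w / adist v u <= adist v w => [wlogd|].
  have [/wlogd//|/Z.lt_le_incl/wlogd] := Z.le_gt_cases (adist v u) (adist v w).
  by rewrite sym mulnC.
have [d0|d_gt0] := Z.le_gt_cases (adist v u) 0.
  have <- : v = u by apply: adist_eq0; have := @adist_ge0 v u; lia.
  apply: leq_trans (leq_pmull _ (itv0 _)).
  apply: uniq_leq_size (hull3_uniq _ _ _) _ => h; rewrite mem_hull3 mem_interval.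
  by rewrite /between3 !betweenZ3_xx.
have := @interval_length v u.
have [d1|d_gt1] := Z.le_gt_cases (adist v u) 1 => len.
  have /(size_hull3_adjacent w)/leq_trans-> // : adist v u = 1 by lia.
  by rewrite leq_mul2r; apply/orP; right; lia.
have := hull3_area (@interval_area_product v u w ltac:(lia) ltac:(lia)).
by rewrite -Nat2Z.inj_mul => /Nat2Z.inj_le/leP.
Qed.

(** * The Cayley graph *)

Local Notation word := (seq ('I_3 * bool)).

Definition act (w : word) z : alcove := foldl (fun z l => step l.1 z) z w.

Lemma act_cat (w1 w2 : word) z : act (w1 ++ w2) z = act w2 (act w1 z).
Proof. exact: foldl_cat. Qed.

(** The defining relations hold for wall crossings, so [act] descends to a right action of the
    group. *)
Lemma act_relator r z : r \in affine_C2_relators -> act r z = z.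
Proof.
case: z => [[[r0 s0] a] b].
have even1 : Z.even (2 * 1 - 1) = false by [].
have even0 : Z.even (2 * 0 - 1) = false by [].
rewrite !inE => /or4P[|||/or3P[]] /eqP->; rewrite /act /power_relator /=;
  case er: (Z.even r0); case es: (Z.even s0); case: a; case: b;
  do ?[rewrite ?Z.even_add ?er ?es ?even1 ?even0 /=]; congr (_, _, _, _); lia.
Qed.

Lemma act_equiv (w1 w2 : word) :
  word_equiv affine_C2_relators w1 w2 -> act w1 =1 act w2.
Proof.
elim=> // [? ? _ eqw z|? ? ? _ eq12 _ eq23 z|? ? ? ? _ eq12 _ eq34 z|i b z|].
- by rewrite eqw.
- by rewrite eq12.
- by rewrite !act_cat eq12 eq34.
- exact: stepK.
- by move=> r rR z; exact: act_relator.
Qed.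

Local Notation W := affine_C2.
Local Notation cls := (word_class affine_C2_relators).

Definition base : alcove := (0, 0, false, true).
Definition alcove_of (x : W) : alcove := act (repr x) base.

Lemma alcove_of_class (w : word) : alcove_of (cls w) = act w base.
Proof. exact/act_equiv/repr_word_class. Qed.

Lemma gen_class i b : cls [:: (i, b)] = affine_C2_gen i.
Proof.
case: b => //; apply: (can_inj (mulgK (affine_C2_gen i))).
rewrite affine_C2_genK -word_classM.
exact/word_classP/(@WordCancel _ _ i false).
Qed.

Lemma alcove_of_gen x i :
  alcove_of (x * affine_C2_gen i)%g = step i (alcove_of x).
Proof.
rewrite -[x](word_class_repr x) -(gen_class i true) -word_classM.
by rewrite !alcove_of_class act_cat.
Qed.

(** * Translations and the inverse of the orbit map *)

Section Inverse.
Local Open Scope group_scope.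
Local Notation s0 := (affine_C2_gen c2_index0).
Local Notation s1 := (affine_C2_gen c2_index1).
Local Notation s2 := (affine_C2_gen c2_index2).

Lemma inv_gen i : (affine_C2_gen i)^-1 = affine_C2_gen i.
Proof. by apply: (mulgI (affine_C2_gen i)); rewrite mulgV affine_C2_genK. Qed.

Lemma gen_mulK x i : x * affine_C2_gen i * affine_C2_gen i = x.
Proof. by rewrite -mulgA affine_C2_genK mulg1. Qed.

Lemma cls_gens (l : seq 'I_3) :
  cls [seq (i, true) | i <- l] = foldr (fun i x => affine_C2_gen i * x) 1 l.
Proof. by elim: l => [|i l IH] //=; rewrite -IH -word_classM. Qed.

Lemma relation n l : power_relator n l \in affine_C2_relators ->
  foldr (fun i x => affine_C2_gen i * x) 1 (flatten (nseq n l)) = 1.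
Proof. by move=> rR; rewrite -cls_gens; apply/word_classP/WordRelator. Qed.

Lemma comm02 : s0 * s2 = s2 * s0.
Proof.
have /= := @relation 2 [:: c2_index0; c2_index2] isT.
rewrite mulg1 !mulgA -(mulgA (s0 * s2)) => /(canRL (mulgK _)).
by rewrite mul1g invgM !inv_gen.
Qed.

Lemma comm20 x : x * s2 * s0 = x * s0 * s2.
Proof. by rewrite -mulgA -comm02 mulgA. Qed.

Lemma braid01 : s0 * s1 * s0 * s1 = s1 * s0 * s1 * s0.
Proof.
have /= := @relation 4 [:: c2_index0; c2_index1] isT.
rewrite mulg1 !mulgA -3!(mulgA (s0 * s1 * s0 * s1)) => /(canRL (mulgK _)).
by rewrite mul1g !invgM !inv_gen !mulgA.
Qed.

Lemma braid12 : s1 * s2 * s1 * s2 = s2 * s1 * s2 * s1.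
Proof.
have /= := @relation 4 [:: c2_index1; c2_index2] isT.
rewrite mulg1 !mulgA -3!(mulgA (s1 * s2 * s1 * s2)) => /(canRL (mulgK _)).
by rewrite mul1g !invgM !inv_gen !mulgA.
Qed.

(* The translations by (2, 0) and (0, 2); they are locked because the rewrite  *)
(* rules for products would otherwise unfold them.                             *)
Definition tr1 : W := locked (s0 * s1 * s2 * s1).
Definition tr2 : W := locked (s0 * s1 * s0 * s1 * s2 * s0).

Lemma tr1s1 x : x * tr1 * s1 = x * s0 * s1 * s2.
Proof. by rewrite /tr1 -lock !mulgA gen_mulK. Qed.

Lemma tr2s0s2s1 x : x * tr2 * s0 * s2 * s1 = x * s0 * s1 * s0.
Proof. by rewrite /tr2 -lock !mulgA !gen_mulK. Qed.

Lemma tr1tr2_eq : tr1 * tr2 = s0 * s1 * s2 * s0 * s1 * s2.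
Proof.
have -> : tr2 = s1 * s0 * s1 * s0 * s2 * s0 by rewrite /tr2 -lock -braid01.
have -> : s1 * s0 * s1 * s0 * s2 * s0 = s1 * s0 * s1 * s2.
  by rewrite -!mulgA -comm02 (mulgA s0 s0) affine_C2_genK mul1g.
by rewrite /tr1 -lock !mulgA gen_mulK.
Qed.

Lemma tr1tr2s2s1 x : x * tr1 * tr2 * s2 * s1 = x * s0 * s1 * s2 * s0.
Proof. by rewrite -(mulgA x) tr1tr2_eq !mulgA !gen_mulK. Qed.

Lemma tr2tr1_eq : tr2 * tr1 = s0 * s1 * s2 * s0 * s1 * s2.
Proof.
rewrite /tr2 /tr1 -!lock !mulgA gen_mulK.
have -> : s0 * s1 * s0 * s1 * s2 * s1 * s2 * s1 =
    s0 * s1 * s0 * (s1 * s2 * s1 * s2) * s1 by rewrite !mulgA.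
rewrite braid12 !mulgA gen_mulK.
by rewrite -(mulgA _ s0 s2) comm02 !mulgA.
Qed.

Lemma comm_tr1tr2 : commute tr1 tr2.
Proof. by rewrite /commute tr1tr2_eq tr2tr1_eq. Qed.

Definition zpow (g : W) (n : Z) : W :=
  if (n <? 0)%Z then g ^- Z.to_nat (- n) else g ^+ Z.to_nat n.

Lemma zpowS g n : zpow g n = zpow g (n - 1)%Z * g.
Proof.
rewrite /zpow; have [n_lt0|n_ge0] := Z.ltb_spec n 0.
  have -> : (n - 1 <? 0)%Z by lia.
  have -> : Z.to_nat (- (n - 1)) = (Z.to_nat (- n)).+1 by lia.
  by rewrite expgS invgM mulgVK.
have [n1_lt0|n1_ge0] := Z.ltb_spec (n - 1) 0.
  have -> : n = 0%Z by lia.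
  by rewrite expg1 mulVg.
have -> : Z.to_nat n = (Z.to_nat (n - 1)).+1 by lia.
by rewrite expgSr.
Qed.

Lemma commute_zpow x g n : commute x g -> commute x (zpow g n).
Proof.
move=> xg; rewrite /zpow; case: ifP => _; last exact: commuteX.
exact: commuteV (commuteX _ xg).
Qed.

(* The square containing (r, s, a, b) is the translate by (2i, 2j) of the one  *)
(* with r = s = 0 or of the one with r = 1, s = 0, where i and j are the       *)
(* integral parts of (r + s) / 2 and (r - s) / 2.                              *)
Definition of_alcove z : W :=
  let: (r, s, a, b) := z in
  zpow tr1 ((r + s) / 2)%Z * zpow tr2 ((r - s) / 2)%Z *
  (if Z.even (r + s)%Z then s0 ^+ a * s2 ^+ ~~ b
   else s0 * s1 * s2 ^+ a * s0 ^+ b).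

Lemma of_alcove_step1_even r s a b : Z.even (r + s)%Z ->
  of_alcove (step c2_index1 (r, s, a, b)) = of_alcove (r, s, a, b) * s1.
Proof.
move=> ev; have [i ri] : exists i, (r + s = 2 * i)%Z by apply/Z.even_spec.
have [j sj] : exists j, (r - s = 2 * j)%Z by exists (i - s)%Z; lia.
have half n : (2 * n / 2 = n)%Z by rewrite Z.mul_comm Z.div_mul.
have half_pred n : ((2 * n - 1) / 2 = n - 1)%Z.
  by rewrite (_ : 2 * n - 1 = 1 + (n - 1) * 2)%Z ?Z.div_add //; lia.
have odd1 n : Z.even (2 * n - 1) = false by rewrite Z.even_sub Z.even_mul.
have half_succ n : ((2 * n + 1) / 2 = n)%Z.
  by rewrite (_ : 2 * n + 1 = 1 + n * 2)%Z ?Z.div_add //; lia.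
have odd2 n : Z.even (2 * n + 1) = false by rewrite Z.even_add Z.even_mul.
rewrite /of_alcove ev ri sj !half.
case: a; case: b => /=.
- have -> : (r + (2 * 1 - 1) + s = 2 * i + 1)%Z by lia.
  have -> : (r + (2 * 1 - 1) - s = 2 * j + 1)%Z by lia.
  by rewrite odd2 !half_succ ?expg0 ?expg1 !mulg1 !mulgA.
- have -> : (r + (s + (2 * 1 - 1)) = 2 * i + 1)%Z by lia.
  have -> : (r - (s + (2 * 1 - 1)) = 2 * j - 1)%Z by lia.
  rewrite odd2 half_succ half_pred ?expg0 ?expg1 !mulg1 !mulgA.
  by rewrite [in RHS](zpowS tr2 j) !mulgA tr2s0s2s1.
- have -> : (r + (s + (2 * 0 - 1)) = 2 * i - 1)%Z by lia.
  have -> : (r - (s + (2 * 0 - 1)) = 2 * j + 1)%Z by lia.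
  rewrite odd1 half_succ half_pred ?expg0 ?expg1 !mulg1 ?mul1g !mulgA.
  have ct := commute_zpow j comm_tr1tr2.
  by rewrite [in RHS](zpowS tr1 i) -(mulgA _ tr1) ct mulgA tr1s1.
- have -> : (r + (2 * 0 - 1) + s = 2 * i - 1)%Z by lia.
  have -> : (r + (2 * 0 - 1) - s = 2 * j - 1)%Z by lia.
  rewrite odd1 !half_pred ?expg0 ?expg1 ?mulg1 ?mul1g !mulgA.
  have ct := commute_zpow (j - 1)%Z comm_tr1tr2.
  rewrite [in RHS](zpowS tr1 i) (zpowS tr2 j) !mulgA -(mulgA _ tr1) ct mulgA.
  by rewrite tr1tr2s2s1.
Qed.

Lemma of_alcove_step i z : of_alcove (step i z) = of_alcove z * affine_C2_gen i.
Proof.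
have iE : [\/ i = c2_index0, i = c2_index1 | i = c2_index2].
  by case: i => [[|[|[|//]]] lti]; [apply: Or31|apply: Or32|apply: Or33];
    apply: val_inj.
case: z => [[[r s] a] b]; case: iE => ->.
- rewrite /of_alcove /step /=; case ev: (Z.even (r + s)) => /=; rewrite ev.
    by case: a; case: b => /=;
      rewrite ?expg0 ?expg1 ?mulg1 ?mul1g ?mulgA ?comm20 ?gen_mulK.
  by case: b => /=; rewrite ?expg0 ?expg1 ?mulg1 ?mulgA ?gen_mulK.
- case ev: (Z.even (r + s)); first exact: of_alcove_step1_even.
  (* Crossing a hypotenuse changes the parity of [r + s] and is an involution, so the odd case is
     the even one read backwards. *)
  move: (stepK c2_index1 (r, s, a, b)).
  case zE: (step c2_index1 (r, s, a, b)) => [[[r' s'] a'] b'] <-.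
  rewrite of_alcove_step1_even ?gen_mulK //.
  move: zE ev; rewrite /step /=; case: ifP => _ [<- <- _ _]; rewrite !Z.even_add;
    by case: (Z.even r); case: (Z.even s); case: (a).
- rewrite /of_alcove /step /=; case ev: (Z.even (r + s)) => /=; rewrite ev.
    by case: b => /=; rewrite ?expg0 ?expg1 ?mulg1 ?mulgA ?gen_mulK.
  by case: a; case: b => /=;
    rewrite ?expg0 ?expg1 ?mulg1 ?mul1g ?mulgA ?comm20 ?gen_mulK.
Qed.

End Inverse.

(** Both maps commute with the generators and [of_alcove base] is 1, so induction on a word applies.
    In particular the action is free: the given relations imply every relation between wall
    crossings. *)
Lemma alcove_ofK : cancel alcove_of of_alcove.
Proof.
move=> x; rewrite -[x](word_class_repr x) alcove_of_class.
elim/last_ind: (repr x) => [|w [i b] IH].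
  by rewrite /= /zpow /= !mulg1.
rewrite -cats1 act_cat word_classM -IH gen_class; exact: of_alcove_step.
Qed.

Lemma alcove_of_inj : injective alcove_of.
Proof. exact: can_inj alcove_ofK. Qed.

Lemma alcove_of1 : alcove_of 1%g = base.
Proof. exact: (alcove_of_class [::]). Qed.

Lemma alcove_of_surj z : exists x, alcove_of x = z.
Proof.
have [n] : exists n, (Z.to_nat (adist z base) <= n)%nat.
  by exists (Z.to_nat (adist z base)).
elim: n z => [|n IH] z dn.
  exists 1%g; rewrite alcove_of1; apply/esym/adist_eq0.
  have := @adist_ge0 z base; lia.
have [->|/eqP zb] := eqVneq z base; first by exists 1%g; exact: alcove_of1.
have [i di] := descent zb; have [|x xE] := IH (step i z); first lia.
by exists (x * affine_C2_gen i)%g; rewrite alcove_of_gen xE stepK.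
Qed.

(** * Graph distance, hulls and cardinals *)

Lemma cayley_gen x y :
  affine_C2_cayley x y <-> exists i, y = (x * affine_C2_gen i)%g.
Proof.
rewrite /affine_C2_cayley /cayley_graph; split=> [|[i ->]].
  by move=> /set_mem[i _ eqi]; exists i; rewrite eqi mulVKg.
by rewrite mulKg; apply/mem_set; exists i.
Qed.

Lemma walk_adist x y n : walk_length affine_C2_cayley x y n ->
  adist (alcove_of x) (alcove_of y) <= Z.of_nat n.
Proof.
case=> p [+ <- <-]; elim: p x => [|y' p IH] x.
  by rewrite /adist !Z.sub_diag.
move=> /andP[/cayley_gen[i ->] /IH]; rewrite alcove_of_gen.
rewrite [last _ (_ :: _)]/= [size (_ :: _)]/=.
rewrite Nat2Z.inj_succ -Z.add_1_l -(adist_step i (alcove_of x)) => le_p.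
exact: Z.le_trans (@adist_triangle _ _ _) (Zplus_le_compat_l _ _ _ le_p).
Qed.

Lemma adist_walk x y :
  walk_length affine_C2_cayley x y
    (Z.to_nat (adist (alcove_of x) (alcove_of y))).
Proof.
move en: (Z.to_nat _) => n; elim: n x en => [|n IH] x en.
  have -> : x = y; last by exists [::].
  apply/alcove_of_inj/adist_eq0.
  have := @adist_ge0 (alcove_of x) (alcove_of y); lia.
have [i di] : exists i, adist (step i (alcove_of x)) (alcove_of y) =
    adist (alcove_of x) (alcove_of y) - 1.
  by apply: descent => exy; move: en; rewrite exy /adist !Z.sub_diag.
have [|p [pP lastp sizep]] := IH (x * affine_C2_gen i)%g.
  by rewrite alcove_of_gen; lia.
exists (x * affine_C2_gen i :: p)%g; split=> //=; last by rewrite sizep.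
by rewrite pP andbT; apply/cayley_gen; exists i.
Qed.

(** An edge changes [adist] to a fixed alcove by at most 1, which bounds walks from below; repeated
    descent gives a walk attaining the bound. *)
Lemma graph_dist_adist x y :
  Z.of_nat (graph_dist affine_C2_cayley x y) = adist (alcove_of x) (alcove_of y).
Proof.
have [/walk_adist le_d min_d] := graph_distP (affine_C2_connected x y).
have /leP := min_d _ (adist_walk x y).
have := @adist_ge0 (alcove_of x) (alcove_of y); lia.
Qed.

Local Open Scope classical_set_scope.

Lemma between_convex_hull x y g :
  between (alcove_of x) (alcove_of y) (alcove_of g) ->
  convex_hull affine_C2_cayley [set x; y] g.
Proof.
move=> /betweenP btw_g C [convC subC]; apply: (convC x y).
- by apply: subC; left.
- by apply: subC; right.
- by apply/Nat2Z.inj; rewrite Nat2Z.inj_add !graph_dist_adist.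
Qed.

Lemma convex_hull_between3 (x y z g : W) :
  convex_hull affine_C2_cayley [set x; y; z] g ->
  between3 (alcove_of x) (alcove_of y) (alcove_of z) (alcove_of g).
Proof.
pose box c := between3 (alcove_of x) (alcove_of y) (alcove_of z) (alcove_of c).
move=> /(_ [set c | box c]); apply; split=> [a b c aC bC eqd|] /=.
  apply: between3_convex aC bC _.
  by rewrite -!graph_dist_adist -Nat2Z.inj_add; exact: (congr1 Z.of_nat eqd).
have /and3P[bx by_ bz_] := between3_id (alcove_of x) (alcove_of y) (alcove_of z).
by move=> _ [[->|->]|->].
Qed.

Lemma card_le_seq (T U : choiceType) (A : set T) (B : set U) (s : seq T)
    (t : seq U) (u0 : U) :
    (forall x, A x -> x \in s) -> (forall y, y \in t -> B y) ->
  uniq t -> (size s <= size t)%nat -> (A #<= B)%card.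
Proof.
move=> As tB ut le_st.
have lt_t x : A x -> (index x s < size t)%nat.
  by move=> /As xs; apply: leq_trans le_st; rewrite index_mem.
have /injfunPex[f] : exists2 f : T -> U, set_fun A B f & set_inj A f.
  exists (fun x => seq.nth u0 t (index x s)) => [x Ax|].
    by apply/tB/mem_nth/lt_t.
  move=> x y /set_mem Ax /set_mem Ay /eqP.
  rewrite nth_uniq ?lt_t // => /eqP eq_idx.
  by rewrite -(nth_index x (As x Ax)) eq_idx nth_index ?As.
exact: inj_card_le f.
Qed.

Lemma of_alcoveK : cancel of_alcove alcove_of.
Proof. by move=> z; have [x <-] := alcove_of_surj z; rewrite alcove_ofK. Qed.

Theorem theorem3p7 : strong_hull_property affine_C2_cayley.
Proof.
move=> u v w; pose a := alcove_of.
(* The hull of three points is enlarged to its box and the hulls of two points are shrunk to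
   intervals, so the count for alcoves suffices. *)
pose between_elts x y := map of_alcove (interval (a x) (a y)).
apply: (@card_le_seq _ _ _ _ (map of_alcove (hull3 (a u) (a v) (a w)))
  [seq (x, y) | x <- between_elts v u, y <- between_elts v w] (1%g, 1%g)).
- move=> g /convex_hull_between3 hg; rewrite -[g]alcove_ofK map_f //.
  by rewrite mem_hull3.
- move=> [x y] /allpairsP[[_ _] /= [/mapP[z + ->] /mapP[z' + ->] [-> ->]]].
  rewrite !mem_interval => bz_ bz'; split => /=.
    by apply: between_convex_hull; rewrite between_sym of_alcoveK.
  by apply: between_convex_hull; rewrite of_alcoveK.
- apply: allpairs_uniq => [||[? ?] [? ?] _ _ [-> ->] //];
    by rewrite (map_inj_uniq (can_inj of_alcoveK)) interval_uniq.
- by rewrite size_allpairs !size_map; apply: size_hull3_le_mul.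
Qed.
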